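(* Let $G$ be a connected graph on $n\geq 3$ vertices with $q(G)=2$. Then \[ |E(G)|\geq\begin{cases}2n-4, & \text{if $n$ is even},\\ 2n-3, & \text{if $n$ is odd}.\end{cases} \] Moreover, for $n$ even, equality $|E(G)|=2n-4$ holds if and only if $G$ is isomorphic to the cube graph $Q_3$ or to a double-ended candle $G_k$ (with $n=2k$); for $n$ odd, equality $|E(G)|=2n-3$ holds if and only if $G$ is isomorphic to a single-ended candle $G'_k$ (with $n=2k+1$).
   Context: All graphs are simple, finite and undirected. For a graph $G$ on $n$ vertices, $\mathcal{S}(G)$ is the set of real symmetric $n\times n$ matrices $A=[a_{ij}]$ such that for $i\neq j$, $a_{ij}\neq 0$ if and only if $\{i,j\}\in E(G)$ (diagonal entries are unrestricted). $q(G)=\min\{q(A): A\in\mathcal{S}(G)\}$, where $q(A)$ is the number of distinct eigenvalues of $A$. $Q_3$ is the 8-vertex graph of the 3-dimensional cube. Double-ended candle: for $k\geq 2$, $G_k$ is the graph on vertex set $\{1,2,\dots,2k\}$ partitioned into levels $L_0=\{1\}$, $L_i=\{2i,2i+1\}$ for $1\leq i\leq k-1$, and $L_k=\{2k\}$, where two vertices are adjacent if and only if they lie in consecutive levels $L_{i-1},L_i$ (every such pair is adjacent). (So $G_2=C_4$; for $k\ge3$, $G_k$ is obtained from the path $1,2,4,\dots,2k-2,2k$ by adding, for each $i=1,\dots,k-1$, a vertex $2i+1$ with the same neighbors as $2i$ and not adjacent to $2i$.) It has $2k$ vertices and $4k-4$ edges; its ends are the vertices $1$ and $2k$. Single-ended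 candle: for $k\geq 1$, $G'_k$ is the graph on vertex set $\{1,\dots,2k+1\}$ with levels $L_0=\{1\}$, $L_i=\{2i,2i+1\}$ for $1\leq i\leq k$, in which two vertices in consecutive levels are always adjacent, the two vertices $2k,2k+1$ of the last level are adjacent, and there are no other edges. (So $G'_1=K_3$, and for $k\ge 2$, $G'_k$ is obtained from $G_k$ by adding a vertex adjacent to $2k$ and to all neighbors of $2k$.) It has $2k+1$ vertices and $4k-1$ edges; its ends are vertex $1$ and the adjacent pair $\{2k,2k+1\}$. *)

(* Defs.v *)
From HB Require Import structures.
From mathcomp Require Import all_boot all_order all_algebra.
From mathcomp Require Import reals.
Set Implicit Arguments. Unset Strict Implicit. Unset Printing Implicit Defensive.
Import Order.TTheory GRing.Theory Num.Theory.
Local Open Scope ring_scope.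

Definition simple_graph (T : finType) (e : rel T) : Prop :=
  symmetric e /\ irreflexive e.

Definition connected_graph (T : finType) (e : rel T) : Prop :=
  forall x y : T, connect e x y.

Definition nedges (n : nat) (e : rel 'I_n) : nat :=
  #|[set p : 'I_n * 'I_n | (p.1 < p.2)%N && e p.1 p.2]|.

Definition graph_iso (T1 T2 : finType) (e1 : rel T1) (e2 : rel T2) : Prop :=
  exists f : T1 -> T2, bijective f /\ forall x y, e1 x y = e2 (f x) (f y).

Definition in_SG (R : realType) (n : nat) (e : rel 'I_n) (A : 'M[R]_n) : Prop :=
  A^T = A /\ forall i j : 'I_n, i != j -> (A i j != 0) = e i j.

Definition num_eig (R : realType) (n : nat) (A : 'M[R]_n) (k : nat) : Prop :=
  exists s : seq R, [/\ uniq s, size s = k & forall a, eigenvalue A a = (a \in s)].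

Definition qG_eq (R : realType) (n : nat) (e : rel 'I_n) (m : nat) : Prop :=
  (exists A : 'M[R]_n, in_SG e A /\ num_eig A m) /\
  (forall (A : 'M[R]_n) k, in_SG e A -> num_eig A k -> (m <= k)%N).

Definition bit (j : nat) (x : nat) : bool := odd (x %/ 2 ^ j).
Definition Q3 : rel 'I_8 := fun x y =>
  ((bit 0 x != bit 0 y) + (bit 1 x != bit 1 y) + (bit 2 x != bit 2 y) == 1)%N.

(* ordinal i of 'I_m represents the vertex with label i+1; its level is
   (i+1)/2: label 1 -> L_0, labels 2i,2i+1 -> L_i, label 2k -> L_k. *)
Definition level (m : nat) (x : 'I_m) : nat := (x.+1)./2.

Definition candle2 (k : nat) : rel 'I_(k.*2) := fun x y =>
  (level x == (level y).+1) || (level y == (level x).+1).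

Definition candle1 (k : nat) : rel 'I_(k.*2.+1) := fun x y =>
  [|| level x == (level y).+1, level y == (level x).+1
    | [&& level x == k, level y == k & x != y]].

(* Main.v *)
Require Import Defs.
From HB Require Import structures.
From mathcomp Require Import all_boot all_order all_algebra.
From mathcomp Require Import reals.
From mathcomp Require Import complex spectral zify ring.
Set Implicit Arguments. Unset Strict Implicit. Unset Printing Implicit Defensive.
Import Order.TTheory GRing.Theory Num.Theory.

(** A symmetric matrix [A] in [S(G)] with two eigenvalues satisfies
    [A^2 = s A - t I].  Hence nonadjacent vertices with a common neighbour have
    two of them, no three independent vertices have pairwise the same two common
    neighbours, and a bipartite [G] has equal sides.

    Let [v] have minimum degree [d >= 2] and split [G] into distance levels from
    [v].  Each vertex of level at least 2 has at least two neighbours one level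
    down, so [2|E| = 4n - 4 - 2d + X] where [X >= 0] sums over the vertices
    the number of neighbours in the same level plus twice the number of downward
    neighbours beyond two.  At or below the claimed bounds this leaves [d = 2] with
    [X <= 2] or [d = 3] with [X <= 4], with [X] smaller by 2 when [n] is even;
    when [n] is odd, [G] is not bipartite and two units of [X] are spent on an
    edge inside a level.  If [d = 2], three vertices in one level would have
    pairwise common children, and two of these children would need a common child
    of their own although they lie over different pairs, which the second common
    neighbour property forbids; so all levels have size at most 2 and [G] is a
    candle.  If [d = 3], the three neighbours of [v] are independent, each two of
    them have exactly one child, and these three children must share one child,
    which gives the cube. *)

(** * The quadratic matrix equation and the combinatorial conditions it forces *)

Section TwoEigenvalues.
Local Open Scope ring_scope.

Lemma eigenvalue_diagonalized (F : fieldType) n (A P : 'M[F]_n) (d : 'rV[F]_n) i :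
  P \in unitmx -> A = invmx P *m diag_mx d *m P -> eigenvalue A (d 0 i).
Proof.
move=> Pu ->; apply/eigenvalueP; exists (row i P).
  rewrite -row_mul !mulmxA mulmxV // mul1mx row_mul row_diag_mx.
  by rewrite -scalemxAl -rowE.
apply/eqP => rP0; have: row i (P *m invmx P) = 0 by rewrite row_mul rP0 mul0mx.
rewrite mulmxV // => /rowP/(_ i); rewrite !mxE eqxx => /eqP.
by rewrite oner_eq0.
Qed.

(** The spectral theorem is applied to the complexification [B] of [A]. Its spectrum is real, so
    each diagonal entry is already an eigenvalue of [A], a root of (X - l)(X - m), and the relation
    is checked on the diagonal form. *)
Lemma two_eigenvalues_quadratic (R : realType) n (A : 'M[R]_n) (l m : R) :
  A^T = A -> (forall a, eigenvalue A a -> a \in [:: l; m]) ->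
  A *m A = (l + m) *: A - (l * m)%:M.
Proof.
move=> symA eigA.
pose f : {rmorphism R -> R[i]} := real_complex R; pose B := map_mx f A.
have Breal : B \is a realmx.
  by apply/mxOverP => i j; rewrite mxE /f /=; apply/complex_realP; exists (A i j).
have Bsym : B \is symmetricmx.
  by apply/is_hermitianmxP; rewrite expr0 scale1r map_mx_id // /B map_trmx symA.
have /orthomx_spectralP := symmetric_normalmx Bsym Breal.
set P := spectralmx B; set d := spectral_diag B => Beq.
have Pu : P \in unitmx by apply: spectral_unit.
have dreal := hermitian_spectral_diag_real (realsym_hermsym Bsym Breal).
have dE i : (d 0 i - f l) * (d 0 i - f m) = 0.
  have := eigenvalue_diagonalized i Pu Beq.
  have /mxOverP/(_ 0 i) := dreal; rewrite -/d => /complex_realP[k ->].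
  rewrite (eigenvalue_map f) => /eigA; rewrite !inE => /orP[]/eqP->.
    by rewrite subrr mul0r.
  by rewrite subrr mulr0.
apply: (@map_mx_inj _ _ f).
rewrite map_mxB map_mxM map_mxZ map_scalar_mx -/B rmorphD rmorphM /=.
have Piu : invmx P \in unitmx by rewrite unitmx_inv.
apply: (can_inj (mulKmx Pu)); apply: (can_inj (mulmxK Piu)).
rewrite !(mulmxBr, mulmxBl) -!scalemxAr -!scalemxAl.
have -> : P *m B *m invmx P = diag_mx d by rewrite Beq !mulmxA mulmxV // mul1mx mulmxK.
rewrite Beq !mulmxA mulmxV // mul1mx mulmxK // mulmxK //.
rewrite -[P *m _ *m _]mulmxA -scalar_mxC mulmxA mulmxV // mul1mx.
apply/matrixP => i j; rewrite mul_diag_mx !mxE.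
case: eqP => [->|_]; rewrite ?mulr1n ?mulr0n; last by ring.
by have := dE j; rewrite -[(real_complex R)]/(f : R -> _) => h; apply/eqP; rewrite -subr_eq0 -h; apply/eqP; ring.
Qed.

Section TwoEigenvalueGraph.
Variables (R : realType) (n : nat) (e : rel 'I_n) (A : 'M[R]_n) (s t : R).
Hypotheses (eA : in_SG e A) (quadA : A *m A = s *: A - t%:M).

Let symA i j : A i j = A j i.
Proof. by rewrite -[in RHS](proj1 eA) mxE. Qed.

Let supp i j : i != j -> (A i j != 0) = e i j.
Proof. exact: (proj2 eA). Qed.

Let zeroA i j : i != j -> ~~ e i j -> A i j = 0.
Proof. by move=> ij; rewrite -supp // negbK => /eqP. Qed.

Let nzA i j : irreflexive e -> e i j -> A i j != 0.
Proof. by move=> irr eij; rewrite supp //; apply: contraL eij => /eqP->; rewrite irr. Qed.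

Lemma row_product i j : i != j -> \sum_k A i k * A j k = s * A i j.
Proof.
move=> ij; have /matrixP/(_ i j) := quadA; rewrite !mxE (negPf ij) mulr0n subr0.
by move=> <-; apply: eq_bigr => k _; rewrite [A j k]symA.
Qed.

Lemma row_product_diag i : \sum_k A i k ^+ 2 = s * A i i - t.
Proof.
have /matrixP/(_ i i) := quadA; rewrite !mxE eqxx mulr1n => <-.
by apply: eq_bigr => k _; rewrite expr2 {2}symA.
Qed.

(** The right side of the quadratic relation vanishes at (i, j). On the left, the terms [k = i] and
    [k = j] contain the factor [A i j = 0], and any other nonzero term needs both edges. *)
Lemma common_nbr_sum i j : i != j -> ~~ e i j ->
  \sum_(k | e i k && e j k) A i k * A j k = 0.
Proof.
move=> ij nij; have Aij := zeroA ij nij.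
have := row_product ij; rewrite Aij mulr0 (bigID (fun k => e i k && e j k)) /=.
rewrite [X in _ + X]big1 ?addr0 // => k; rewrite negb_and.
have [<- _|ik] := eqVneq i k; first by rewrite [A j i]symA Aij mulr0.
have [<- _|jk] := eqVneq j k; first by rewrite Aij mul0r.
by case/orP => ne; rewrite (zeroA _ ne) ?mul0r ?mulr0.
Qed.

(** A vanishing sum cannot consist of a single nonzero term. *)
Lemma second_common_nbr i j k : irreflexive e ->
  i != j -> ~~ e i j -> e i k -> e j k ->
  exists2 l, l != k & e i l && e j l.
Proof.
move=> irr ij nij ik jk.
have [l /andP[lk el]|none] := pickP (fun l => (l != k) && (e i l && e j l)).
  by exists l.
have := common_nbr_sum ij nij; rewrite (bigD1 k) /= ?ik //.
rewrite big1 => [|l]; last by rewrite andbC none.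
by rewrite addr0 => /eqP; rewrite mulf_eq0 (negPf (nzA irr ik)) (negPf (nzA irr jk)).
Qed.

Lemma common_nbr_pair i j p q : i != j -> ~~ e i j -> p != q ->
  (forall k, e i k && e j k = (k == p) || (k == q)) ->
  A i p * A j p = - (A i q * A j q).
Proof.
move=> ij nij pq cm; have := common_nbr_sum ij nij.
rewrite (eq_bigl _ _ cm) (bigD1 p) ?eqxx //= (bigD1 q) /=; last first.
  by rewrite eqxx orbT eq_sym.
rewrite big1 ?addr0 => [/eqP|k]; first by rewrite addr_eq0 => /eqP.
by case: eqP => //= _; case: eqP.
Qed.

(* The rows of [x], [y], [z] would restrict on [{p, q}] to three pairwise
   orthogonal vectors of the plane with nonzero entries. *)
Lemma no_three_sharing_pair x y z p q : irreflexive e ->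
  x != y -> x != z -> y != z -> ~~ e x y -> ~~ e x z -> ~~ e y z -> p != q ->
  (forall k, e x k && e y k = (k == p) || (k == q)) ->
  (forall k, e x k && e z k = (k == p) || (k == q)) ->
  (forall k, e y k && e z k = (k == p) || (k == q)) -> False.
Proof.
move=> irr xy xz yz nxy nxz nyz pq cxy cxz cyz.
have h1 := common_nbr_pair xy nxy pq cxy.
have h2 := common_nbr_pair xz nxz pq cxz.
have h3 := common_nbr_pair yz nyz pq cyz.
have : e x p && e y p by rewrite cxy eqxx.
have : e y p && e z p by rewrite cyz eqxx.
case/andP=> /(nzA irr) yp /(nzA irr) zp /andP[/(nzA irr) xp _].
have : (A x p ^+ 2 + A x q ^+ 2) * (A y p * A z p) = 0.
  transitivity ((A x p * A y p) * (A x p * A z p) + A x q ^+ 2 * (A y p * A z p)); first by ring.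
  by rewrite h1 h2 h3; ring.
apply/eqP; rewrite !mulf_neq0 // gt_eqF // ltr_wpDr ?sqr_ge0 //.
by rewrite exprn_even_gt0.
Qed.

(** By [offdiagE] this depends only on [A i i], and is unchanged when [A i i] is replaced by
    [s - A i i]. *)
Let offdiag i := \sum_(k | k != i) A i k ^+ 2.

Let offdiagE i : offdiag i = A i i * (s - A i i) - t.
Proof.
have := row_product_diag i; rewrite (bigD1 i) //= -/(offdiag i) => h.
by apply: (addrI (A i i ^+ 2)); rewrite h; ring.
Qed.

(** [offdiag] is a positive constant on the graph. The squared entries between the two sides give
    the same total when summed from either side, so the sides have equal size. *)
Lemma bipartite_even (c : 'I_n -> bool) : simple_graph e -> connected_graph e ->
  (1 < n)%N -> (forall i j, e i j -> c i != c j) -> ~~ odd n.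
Proof.
move=> [sym irr] conn n1 ec.
have adjE i j : e i j -> offdiag i = offdiag j.
  move=> eij; have ij : i != j by apply: contraL eij => /eqP->; rewrite irr.
  (* An edge of a bipartite graph lies in no triangle, so only [k = i] and [k = j] survive in the
     (i, j) entry of the square. *)
  have sE : A i i + A j j = s.
    have := row_product ij; rewrite (bigD1 i) //= (bigD1 j) /=; last by rewrite eq_sym.
    rewrite big1 => [|k /andP[ki kj]].
      rewrite addr0 [A j i]symA => h; apply: (mulIf (nzA irr eij)).
      by rewrite -h; ring.
    have [eik|nik] := boolP (e i k); last by rewrite (zeroA _ nik) ?mul0r // eq_sym.
    have [ejk|njk] := boolP (e j k); last by rewrite (zeroA _ njk) ?mulr0 // eq_sym.
    by have := ec _ _ eij; have := ec _ _ eik; have := ec _ _ ejk; do 3!case: (c _).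
  by rewrite !offdiagE -sE; ring.
have [i0 _] : exists i0 : 'I_n, true by exists (Ordinal (ltnW n1)).
have constE i : offdiag i = offdiag i0.
  have /connectP[p] := conn i0 i; elim/last_ind: p i => [|p x IH] i /=; first by move=> _ ->.
  by rewrite rcons_path last_rcons => /andP[pp eix] ->; rewrite -(adjE _ _ eix) (IH _ pp).
have pos : 0 < offdiag i0.
  have [j0 j0i] : exists j0, j0 != i0.
    have : (1 < #|'I_n|)%N by rewrite card_ord.
    by case/card_gt1P => x [y [_ _ xy]]; have [xi|] := eqVneq x i0; [exists y; rewrite -xi eq_sym | exists x].
  have [j eij] : exists j, e i0 j.
    have /connectP[[|j p] /=] := conn i0 j0; first by move=> _ h; rewrite h eqxx in j0i.
    by case/andP=> h _ _; exists j.
  have ji : j != i0 by apply: contraL eij => /eqP->; rewrite irr.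
  rewrite /offdiag (bigD1 j) //= ltr_wpDr //.
    by apply: sumr_ge0 => k _; rewrite sqr_ge0.
  by rewrite exprn_even_gt0 // (nzA irr eij).
have sideE b : \sum_(i | c i == b) offdiag i = #|[pred i | c i == b]|%:R * offdiag i0.
  by rewrite (eq_bigr _ (fun i _ => constE i)) sumr_const mulr_natl.
have oppE i b : c i == b -> offdiag i = \sum_(k | c k == ~~ b) A i k ^+ 2.
  move=> cib; rewrite /offdiag [LHS](bigID (fun k => c k == ~~ b)) /=.
  rewrite [X in _ + X]big1 ?addr0 => [|k /andP[ki ck]].
    apply: eq_bigl => k; have [->|] := eqVneq k i => //=.
    by rewrite (eqP cib); case: (b).
  rewrite (zeroA (j := k)) ?expr0n //; first by rewrite eq_sym.
  by apply/negP => /ec; move: ck; rewrite (eqP cib); case: (c k); case: (b).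
have : \sum_(i | c i == true) offdiag i = \sum_(i | c i == false) offdiag i.
  rewrite (eq_bigr _ (fun i => @oppE i true)) (eq_bigr _ (fun i => @oppE i false)).
  rewrite exchange_big; apply: eq_bigr => i _; apply: eq_bigr => k _.
  by rewrite symA.
rewrite !sideE => /(mulIf (lt0r_neq0 pos)) /eqP; rewrite eqr_nat => /eqP cc.
have := cardC [pred i | c i == true]; rewrite card_ord => <-.
rewrite cc (eq_card (_ : predC _ =i [pred i | c i == false])) ?addnn ?odd_double //.
by move=> i; rewrite !inE; case: (c i).
Qed.
End TwoEigenvalueGraph.

End TwoEigenvalues.

(** * Degrees, distance levels and edge counting by level *)

Definition degree (T : finType) (e : rel T) (x : T) : nat := #|[pred y | e x y]|.

Lemma card_pred_sum (T : finType) (P : pred T) : #|[pred y | P y]| = \sum_y (P y : nat).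
Proof. by rewrite -sum1_card big_mkcond. Qed.

Lemma degree_sum n (e : rel 'I_n) : simple_graph e ->
  \sum_x degree e x = (nedges e).*2.
Proof.
move=> [sym irr].
pose sw (p : 'I_n * 'I_n) := (p.2, p.1).
have swK : involutive sw by case.
have -> : \sum_x degree e x = \sum_(p : 'I_n * 'I_n) (e p.1 p.2 : nat).
  rewrite -(pair_bigA _ (fun x y => (e x y : nat))) /=; apply: eq_bigr => x _.
  by rewrite -big_mkcond sum1_card.
rewrite /nedges -addnn.
rewrite -[in X in _ = _ + X](card_imset _ (can_inj swK)).
have cardE (S : {set 'I_n * 'I_n}) : #|S| = \sum_p (p \in S : nat).
  by rewrite -big_mkcond sum1_card.
rewrite !cardE -big_split; apply: eq_bigr => -[x y] _ /=.
rewrite inE /= -[(x, y) in X in _ = _ + X]/(sw (y, x)).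
rewrite (mem_imset _ _ (can_inj swK)) inE /= (sym y x).
by case: ltngtP => [_|_|/val_inj->]; rewrite /= ?addn0 ?irr.
Qed.

(** These are the properties of the distance from [v] that the argument uses; for symmetric [e],
    [lev_step] bounds the level change along an edge in both directions. *)
Record layering (T : finType) (e : rel T) (v : T) (lev : T -> nat) : Prop := Layering {
  lev_root : forall x, (lev x == 0) = (x == v);
  lev_step : forall x y, e x y -> lev y <= (lev x).+1;
  lev_parent : forall x, x != v -> exists2 y, e x y & (lev y).+1 = lev x }.

(** The level of [x] is the least length of a walk from [v] to [x]. Walks of length [k] are tuples,
    so that their existence is a boolean. *)
Lemma layering_exists (T : finType) (e : rel T) (v : T) :
  symmetric e -> connected_graph e -> exists lev, layering e v lev.
Proof.
move=> sym conn.
pose reach x k := [exists p : k.-tuple T, path e v p && (last v p == x)].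
have reachP x k : reflect (exists2 p, path e v p & (last v p == x) && (size p == k)) (reach x k).
  apply: (iffP existsP) => [[p /andP[h1 h2]]|[p h1 /andP[h2 h3]]].
    by exists p => //; rewrite h2 size_tuple eqxx.
  by exists (Tuple h3); rewrite h1.
have ex x : exists k, reach x k.
  by have /connectP[p h1 h2] := conn v x; exists (size p); apply/reachP; exists p; rewrite // -h2 !eqxx.
exists (fun x => ex_minn (ex x)); split=> [x|x y exy|x xv].
- case: ex_minnP => k /reachP[p _ /andP[/eqP lp /eqP <-]] mk.
  apply/idP/eqP => [/nilP p0|xv]; first by rewrite -lp p0.
  by rewrite -leqn0; apply: mk; rewrite xv; apply/reachP; exists [::]; rewrite //= !eqxx.
- case: (ex_minnP (ex y)) => k _; apply; case: (ex_minnP (ex x)) => j /reachP[p pp /andP[/eqP lp /eqP <-]] _.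
  by apply/reachP; exists (rcons p y); rewrite ?rcons_path ?pp ?lp // last_rcons size_rcons !eqxx.
- case: (ex_minnP (ex x)) => k /reachP[p]; elim/last_ind: p => [|p y _].
    by move=> _ /andP[/= /eqP vx]; rewrite vx eqxx in xv.
  rewrite rcons_path last_rcons size_rcons => /andP[pp ey] /andP[/eqP <-{x xv} /eqP <-] mk.
  exists (last v p); first by rewrite sym.
  case: ex_minnP => j /reachP[q qp /andP[/eqP lq /eqP <-]] mj; apply/eqP.
  rewrite eqn_leq ltnS mj; last by apply/reachP; exists p; rewrite // !eqxx.
  by apply: mk; apply/reachP; exists (rcons q y); rewrite ?rcons_path ?qp ?lq // last_rcons size_rcons !eqxx.
Qed.

Definition down (T : finType) (e : rel T) (lev : T -> nat) (x : T) : nat :=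
  #|[pred y | e x y && ((lev y).+1 == lev x)]|.
Definition side (T : finType) (e : rel T) (lev : T -> nat) (x : T) : nat :=
  #|[pred y | e x y && (lev y == lev x)]|.
(** The share of [x] in [X]. By truncated subtraction, the root and its neighbours, with fewer than
    two downward neighbours, contribute only edges inside their level. *)
Definition excess (T : finType) (e : rel T) (lev : T -> nat) (x : T) : nat :=
  side e lev x + (down e lev x - 2).*2.

Section LevelCount.
Variables (T : finType) (e : rel T) (lev : T -> nat).
Hypotheses (sym : symmetric e) (step : forall x y, e x y -> lev y <= (lev x).+1).

(** Every edge between levels is upward from one end and downward from the other, so the two kinds
    have the same total. *)
Lemma degree_sum_levels :
  \sum_x degree e x = \sum_x (side e lev x + (down e lev x).*2).
Proof.
pose up x := #|[pred y | e x y && (lev y == (lev x).+1)]|.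
have dE x : degree e x = side e lev x + down e lev x + up x.
  rewrite /degree /side /down /up !card_pred_sum -!big_split /=.
  apply: eq_bigr => y _; have [exy|] //= := boolP (e x y).
  have := step exy; have := @step y x; rewrite sym => /(_ exy).
  by case: eqP; case: eqP; case: eqP; lia.
rewrite (eq_bigr _ (fun x _ => dE x)) big_split /=.
rewrite (_ : \sum_x up x = \sum_x down e lev x) -?big_split /=.
  by apply: eq_bigr => x _; rewrite -addnn addnA.
rewrite /up /down; under eq_bigr do rewrite card_pred_sum.
under [RHS]eq_bigr do rewrite card_pred_sum.
rewrite exchange_big; apply: eq_bigr => x _; apply: eq_bigr => y _.
by rewrite sym eq_sym.
Qed.

Lemma excess_ge x s1 s2 : uniq s1 -> uniq s2 ->
  all (fun y => e x y && ((lev y).+1 == lev x)) s1 ->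
  all (fun y => e x y && (lev y == lev x)) s2 ->
  size s2 + (size s1 - 2).*2 <= excess e lev x.
Proof.
move=> u1 u2 /allP a1 /allP a2; rewrite /excess leq_add //.
  by rewrite /side -(card_uniqP u2); apply/subset_leq_card/subsetP => y /a2.
by rewrite leq_double leq_sub2r // /down -(card_uniqP u1); apply/subset_leq_card/subsetP => y /a1.
Qed.

Lemma excess_budget s : uniq s ->
  \sum_(x <- s) excess e lev x <= \sum_x excess e lev x.
Proof.
move=> us; rewrite big_uniq //= [X in _ <= X](bigID (mem s)) /= leq_addr //.
Qed.

End LevelCount.

(** * Arithmetic tactic, short lists and labelling by levels *)

Ltac nat_fact P :=
  lazymatch P with
  | @eq_op _ ?a _ = false => let t := type of a in unify t nat
  | @eq ?t _ _ => unify t nat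
  | not (@eq ?t _ _) => unify t nat
  | is_true (leq _ _) => idtac
  | is_true (negb (leq _ _)) => idtac
  | is_true (@eq_op _ ?a _) => let t := type of a in unify t nat
  | is_true (negb (@eq_op _ ?a _)) => let t := type of a in unify t nat
  end.

(* [lia] blows up on contexts with many boolean adjacency hypotheses, so only
   facts about natural numbers are kept. *)
Ltac nlia :=
  repeat match goal with H : ?P |- _ => tryif nat_fact P then fail else clear H end;
  lia.

Lemma uniq3 (T : eqType) (x y z : T) : x != y -> x != z -> y != z -> uniq [:: x; y; z].
Proof. by move=> /negPf a /negPf b /negPf c; rewrite /= !inE a b c. Qed.

Lemma uniq4 (T : eqType) (x y z w : T) :
  x != y -> x != z -> x != w -> y != z -> y != w -> z != w -> uniq [:: x; y; z; w].
Proof.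
by move=> /negPf a /negPf b /negPf c d f g; rewrite cons_uniq uniq3 // !inE a b c.
Qed.

Lemma card_levels (T : finType) (lev : T -> nat) D : (forall x, lev x <= D) ->
  #|T| = \sum_(i < D.+1) #|[pred x | lev x == i]|.
Proof.
move=> top; rewrite -sum1_card; under [RHS]eq_bigr do rewrite card_pred_sum.
rewrite exchange_big /=; apply: eq_bigr => x _.
rewrite (bigD1 (Ordinal (top x : lev x < D.+1))) //= eqxx big1 // => i.
by rewrite -val_eqE /= eq_sym => /negPf->.
Qed.

(** A vertex of level [i > 0] goes to ordinal [2i - 1] or [2i], with [enum_rank] ordering two
    vertices of one level. The bounds by [m] say that these ordinals exist; injectivity and equal
    cardinalities give the bijection. *)
Lemma level_labelling (T : finType) (lev : T -> nat) m : #|T| = m ->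
  (forall x, (lev x).*2.-1 < m) ->
  (forall x y, x != y -> lev y = lev x -> (lev x).*2 < m) ->
  (forall x y, lev x = 0 -> lev y = 0 -> x = y) ->
  (forall x y z, lev y = lev x -> lev z = lev x -> uniq [:: x; y; z] -> False) ->
  exists f : T -> 'I_m, bijective f /\ forall x, level (f x) = lev x.
Proof.
move=> cT lm1 lm2 l0 l2.
pose lo x y := (lev y == lev x) && (enum_rank y < enum_rank x).
pose b x := [exists y, lo x y].
pose f x := if lev x == 0 then 0 else (lev x).*2.-1 + b x.
have fm x : f x < m.
  rewrite /f /b; case: eqP => l; first by rewrite -cT; apply/card_gt0P; exists x.
  case: existsP => [[y /andP[/eqP ly xy]]|_]; last by rewrite addn0.
  have : y != x by apply: contraTneq xy => ->; rewrite ltnn.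
  by rewrite eq_sym => /lm2 /(_ ly); lia.
have fl x : (f x).+1./2 = lev x.
  by rewrite /f; case: eqP => [->|] //; case: (b x); lia.
pose g x : 'I_m := Ordinal (fm x).
have gl x : level (g x) = lev x by apply: fl.
exists g; split=> //.
apply: inj_card_bij; last by rewrite card_ord cT.
move=> x y gxy; have lxy : lev y = lev x by rewrite -!gl gxy.
apply/eqP/negPn/negP => xy.
wlog lt : x y gxy lxy xy / enum_rank x < enum_rank y.
  move=> W; case: (ltngtP (enum_rank x) (enum_rank y)) => [|lt|/val_inj/enum_rank_inj exy].
  - exact: W.
  - by apply: (W y x) => //; rewrite eq_sym.
  - by rewrite exy eqxx in xy.
have : f x = f y by apply: (congr1 val gxy).
rewrite /f lxy; case: eqP => [lx0|lx0 /addnI].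
  by rewrite (l0 x y) ?lxy ?eqxx // in xy.
have -> : b y by apply/existsP; exists x; rewrite /lo lxy eqxx lt.
rewrite /b; case: existsP => // -[z /andP[/eqP lz zx]] _.
apply: (l2 x y z) => //; apply: uniq3 => //.
  by apply: contraTneq zx => ->; rewrite ltnn.
by apply: contraTneq lt => ->; rewrite -leqNgt ltnW.
Qed.

(** * Levels of a graph with the second common neighbour property *)

Section LayeredGraph.
Variables (T : finType) (e : rel T) (v : T) (lev : T -> nat).
Hypotheses (sym : symmetric e) (irr : irreflexive e).
Hypothesis second_nbr : forall x y k, x != y -> ~~ e x y -> e x k -> e y k ->
  exists2 l, l != k & e x l && e y l.
Hypothesis lay : layering e v lev.

Notation ex := (excess e lev).
Notation X := (\sum_x ex x).

Lemma lev_adj x y : e x y -> lev y <= (lev x).+1 /\ lev x <= (lev y).+1.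
Proof. by move=> exy; rewrite !(lev_step lay) // sym. Qed.

Lemma adj_neq x y : e x y -> x != y.
Proof. by apply: contraL => /eqP->; rewrite irr. Qed.

Lemma lev_neq x y : lev x != lev y -> x != y.
Proof. by apply: contraNneq => ->. Qed.

Lemma nonadj_lev x y : (lev x).+1 < lev y -> ~~ e x y.
Proof. by move=> lt; apply/negP => /lev_adj; nlia. Qed.

Lemma parent x : 0 < lev x -> exists2 y, e x y & (lev y).+1 = lev x.
Proof. by rewrite lt0n (lev_root lay) => /(lev_parent lay). Qed.

Lemma lev1E x : (lev x == 1) = e v x.
Proof.
have lv : lev v = 0 by apply/eqP; rewrite (lev_root lay).
apply/idP/idP => [/eqP l1|/[dup] evx /lev_adj].
  have [y xy] : exists2 y, e x y & (lev y).+1 = lev x by apply: parent; rewrite l1.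
  by rewrite l1 => -[] /eqP; rewrite (lev_root lay) => /eqP yv; rewrite sym -yv.
have := lev_root lay x; rewrite [x == v]eq_sym (negPf (adj_neq evx)); nlia.
Qed.

Lemma level_inhabited x i : i <= lev x -> exists y, lev y = i.
Proof.
elim: (lev x) {-2}x (erefl (lev x)) => [|l IH] y ly; first by rewrite ly leqn0 => /eqP->; exists y.
rewrite leq_eqVlt => /orP[/eqP->|]; first by exists y.
have [|z _ lz] := @parent y; first by rewrite ly.
by rewrite ly ltnS => il; apply: (IH z); nlia.
Qed.

(** A parent [p] of [x] has a parent [u], two levels below [x]. The second common neighbour of [u]
    and [x] lies in the level of [p]. *)
Lemma two_parents x : 1 < lev x -> exists p q,
  [/\ p != q, e x p, e x q, (lev p).+1 = lev x & (lev q).+1 = lev x].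
Proof.
move=> x1; have [p xp lp] := @parent x (ltnW x1).
have [|u pu lu] := @parent p; first by nlia.
have [l lp' /andP[ul xl]] : exists2 l, l != p & e u l && e x l.
  by apply: second_nbr => //; [apply: lev_neq; nlia | apply: nonadj_lev; nlia | rewrite sym].
exists p, l; split; rewrite ?[p == _]eq_sym //.
by have := lev_adj ul; have := lev_adj xl; nlia.
Qed.

(** In [degree_sum_levels] a vertex of level at least 2 contributes 4 plus its excess. The root
    falls short by 4 and each of its neighbours by 2, which accounts for the terms added on the
    left. *)
Lemma degree_excess : \sum_x degree e x + 4 + (degree e v).*2 = 4 * #|T| + X.
Proof.
have lv : lev v = 0 by apply/eqP; rewrite (lev_root lay).
rewrite (degree_sum_levels sym (@lev_step _ _ _ _ lay)).
have d2 : (degree e v).*2 = \sum_x (e v x).*2.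
  by rewrite /degree card_pred_sum -!muln2 big_distrl /=; apply: eq_bigr => x _; rewrite muln2.
have v4 : \sum_x (if x == v then 4 else 0) = 4 by rewrite -big_mkcond big_pred1_eq.
have T4 : \sum_(x : T) 4 = 4 * #|T| by rewrite sum_nat_const mulnC.
rewrite d2 -{}T4 -[X in _ + X + _]v4.
rewrite -!big_split /=; apply: eq_bigr => x _; rewrite /excess -lev1E -(lev_root lay).
have [l0|l0] := posnP (lev x).
  by rewrite /down (eq_card0 (_ : _ =i pred0)) => [|y]; rewrite ?inE l0 //= ?andbF // addn0 addnC.
have [l1|l1] := leqP (lev x) 1.
  have {l0}l1 : lev x = 1 by nlia.
  suff -> : down e lev x = 1 by rewrite l1 /=; nlia.
  rewrite /down (@eq_card1 _ v) // => y; rewrite !inE l1 eqSS (lev_root lay).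
  by case: eqP => [->|]; rewrite ?andbF // sym -lev1E l1 eqxx.
have [p [q [pq xp xq lp lq]]] := two_parents l1.
have : 2 <= down e lev x.
  rewrite /down -[2]/(size [:: p; q]) -(card_uniqP (_ : uniq [:: p; q])) /= ?inE ?pq //.
  by apply/subset_leq_card/subsetP => y; rewrite !inE => /orP[]/eqP->; rewrite ?xp ?xq ?lp ?lq eqxx.
have -> : (lev x == 1) = false by nlia.
nlia.
Qed.

Lemma excess_side1 x y : e x y -> lev y = lev x -> 0 < ex x.
Proof.
move=> exy ly; apply: (@excess_ge _ _ _ _ [::] [:: y]) => //=.
by rewrite exy ly eqxx.
Qed.

Lemma excess_side2 x y z : e x y -> e x z -> y != z -> lev y = lev x -> lev z = lev x -> 1 < ex x.
Proof.
move=> exy exz yz ly lz; apply: (@excess_ge _ _ _ _ [::] [:: y; z]) => //=.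
  by rewrite inE yz.
by rewrite exy exz ly lz eqxx.
Qed.

Lemma excess_down3 x p q r : e x p -> e x q -> e x r -> uniq [:: p; q; r] ->
  (lev p).+1 = lev x -> (lev q).+1 = lev x -> (lev r).+1 = lev x -> 1 < ex x.
Proof.
move=> xp xq xr u lp lq lr; apply: (@excess_ge _ _ _ _ [:: p; q; r] [::]) => //=.
by rewrite xp xq xr lp lq lr eqxx.
Qed.

Lemma excess_down3_side2 x p q r y z : e x p -> e x q -> e x r -> uniq [:: p; q; r] ->
  (lev p).+1 = lev x -> (lev q).+1 = lev x -> (lev r).+1 = lev x ->
  e x y -> e x z -> y != z -> lev y = lev x -> lev z = lev x -> 3 < ex x.
Proof.
move=> xp xq xr u lp lq lr xy xz yz ly lz.
apply: (@excess_ge _ _ _ _ [:: p; q; r] [:: y; z]) => //=; rewrite ?inE ?yz //.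
  by rewrite xp xq xr lp lq lr eqxx.
by rewrite xy xz ly lz eqxx.
Qed.

Lemma excess_le1_down x : ex x <= 1 -> down e lev x <= 2.
Proof. rewrite /excess; nlia. Qed.

Lemma two_downs x p q r : down e lev x <= 2 -> p != q -> e x p -> e x q -> e x r ->
  (lev p).+1 = lev x -> (lev q).+1 = lev x -> (lev r).+1 = lev x ->
  (r == p) || (r == q).
Proof.
move=> x2 pq xp xq xr lp lq lr; apply/negPn/negP => /norP[rp rq].
suff : 2 < down e lev x by rewrite ltnNge x2.
rewrite -[3]/(size [:: p; q; r]) -(card_uniqP (_ : uniq [:: p; q; r])) /=.
  apply/subset_leq_card/subsetP => y; rewrite !inE.
  by case/or3P=> /eqP->; rewrite ?xp ?xq ?xr ?lp ?lq ?lr eqxx.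
by rewrite !inE negb_or pq ![_ == r]eq_sym rp rq.
Qed.

(** The vertices [p] and [y] are two levels apart and share [x]; their second common neighbour is a
    downward neighbour of [y] other than [x], hence [x']. *)
Lemma same_down y x x' p : down e lev y <= 2 -> x != x' -> e y x -> e y x' ->
  (lev x).+1 = lev y -> (lev x').+1 = lev y ->
  e x p -> (lev p).+1 = lev x -> e x' p.
Proof.
move=> y1 xx' yx yx' lx lx' xp lp.
have [l lx0 /andP[pl yl]] : exists2 l, l != x & e p l && e y l.
  by apply: second_nbr => //; [apply: lev_neq; nlia | apply: nonadj_lev; nlia | rewrite sym].
have ll : (lev l).+1 = lev y by have := lev_adj pl; have := lev_adj yl; nlia.
have := two_downs y1 xx' yx yx' yl lx lx' ll; rewrite (negPf lx0) => /eqP <-.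
by rewrite sym.
Qed.

Lemma budget2 x y : x != y -> ex x + ex y <= X.
Proof.
move=> xy; have := excess_budget e lev (_ : uniq [:: x; y]).
by rewrite !big_cons big_nil addn0; apply; rewrite /= inE xy.
Qed.

Lemma budget3 x y z : uniq [:: x; y; z] -> ex x + ex y + ex z <= X.
Proof. by move/(excess_budget e lev); rewrite !big_cons big_nil addn0 !addnA. Qed.

Lemma budget4 x y z w : uniq [:: x; y; z; w] -> ex x + ex y + ex z + ex w <= X.
Proof. by move/(excess_budget e lev); rewrite !big_cons big_nil addn0 !addnA. Qed.

Lemma budget5 x y z w u : uniq [:: x; y; z; w; u] ->
  ex x + ex y + ex z + ex w + ex u <= X.
Proof. by move/(excess_budget e lev); rewrite !big_cons big_nil addn0 !addnA. Qed.

(** * Root of degree two: the candles *)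

Section Ladder.
Hypothesis no_three_sharing : forall x y z p q,
  x != y -> x != z -> y != z -> ~~ e x y -> ~~ e x z -> ~~ e y z -> p != q ->
  (forall k, e x k && e y k = (k == p) || (k == q)) ->
  (forall k, e x k && e z k = (k == p) || (k == q)) ->
  (forall k, e y k && e z k = (k == p) || (k == q)) -> False.
Hypothesis X2 : X <= 2.
Hypothesis down2 : forall x, down e lev x <= 2.

Lemma shared_child x1 x2 p q u : p != q -> x1 != x2 -> ~~ e x1 x2 ->
  e x1 p -> e x1 q -> e x2 p -> e x2 q -> e u p -> e u q ->
  (lev p).+1 = lev x1 -> (lev q).+1 = lev x1 -> lev x2 = lev x1 ->
  (lev u).+2 = lev x1 ->
  exists t, [/\ e x1 t, e x2 t & lev t = (lev x1).+1].
Proof.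
move=> pq x12 n12 x1p x1q x2p x2q up uq lp lq l2 lu.
have [t /and3P[h1 h2 /eqP h3]|none] :=
  pickP (fun t => [&& e x1 t, e x2 t & lev t == (lev x1).+1]); first by exists t.
have below x : e x p -> e x q -> lev x = lev x1 ->
    forall k, e u k && e x k = (k == p) || (k == q).
  move=> xp xq lx k; apply/andP/orP => [[uk xk]|[]/eqP->] //.
  apply/orP; apply: (two_downs (down2 x)) => //; rewrite ?lx //.
  by have := lev_adj uk; have := lev_adj xk; nlia.
case: (@no_three_sharing u x1 x2 p q) => //.
- by apply: lev_neq; nlia.
- by apply: lev_neq; nlia.
- by apply: nonadj_lev; nlia.
- by apply: nonadj_lev; nlia.
- exact: below.
- exact: below.
move=> k; apply/andP/orP => [[h1 h2]|[]/eqP->] //; apply/orP.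
(* A common neighbour inside the level would have excess 2, and [x1] excess 1, against a total of at
   most 2. *)
have := none k; rewrite h1 h2 /= => /eqP nk.
have [lk|lk] := eqVneq (lev k) (lev x1); last first.
  apply: (two_downs (down2 x1)) => //.
  by have := lev_adj h1; nlia.
have k2 : 1 < ex k by apply: (@excess_side2 k x1 x2); rewrite ?[e k _]sym ?lk.
have s1 : 0 < ex x1 by apply: (@excess_side1 x1 k); rewrite ?lk.
by have := @budget2 k x1; rewrite eq_sym (adj_neq h1) => /(_ isT); nlia.
Qed.

(** Once the triple is independent, [x1] has a child [t] in common with [x2] and a child [w] in
    common with [x3], and the second common neighbour of [t] and [w] has nowhere to lie. *)
Lemma no_triple x1 x2 x3 p q u : uniq [:: x1; x2; x3] -> p != q ->
  e x1 p -> e x1 q -> e x2 p -> e x2 q -> e x3 p -> e x3 q -> e u p -> e u q ->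
  (lev p).+1 = lev x1 -> (lev q).+1 = lev x1 ->
  lev x2 = lev x1 -> lev x3 = lev x1 -> (lev u).+2 = lev x1 -> False.
Proof.
move=> u3 pq; pose L := lev x1.
(* An edge inside the triple costs one unit at each end. The second common neighbour of [y2] and the
   child [t] of [y1], [y3] then forces a third unit. *)
have indep y1 y2 y3 : uniq [:: y1; y2; y3] -> e y1 p -> e y1 q -> e y2 p ->
    e y2 q -> e y3 p -> e y3 q -> e u p -> e u q ->
    (lev p).+1 = lev y1 -> (lev q).+1 = lev y1 -> lev y2 = lev y1 ->
    lev y3 = lev y1 -> (lev u).+2 = lev y1 -> ~~ e y1 y2.
  move=> uy y1p y1q y2p y2q y3p y3q up uq lp lq l2 l3 lu; apply/negP => y12.
  move: (uy); rewrite /= !inE !negb_or andbT => /andP[/andP[d12 d13] d23].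
  have s1 : 0 < ex y1 by apply: (@excess_side1 y1 y2).
  have s2 : 0 < ex y2 by apply: (@excess_side1 y2 y1) => //; rewrite sym.
  have n13 : ~~ e y1 y3.
    apply/negP => y13; have := budget2 d12.
    by have := @excess_side2 y1 y2 y3 y12 y13 d23 l2 l3; nlia.
  have [t [y1t y3t lt]] := @shared_child y1 y3 p q u pq d13 n13 y1p y1q y3p y3q up uq lp lq l3 lu.
  have n2t : ~~ e y2 t.
    apply/negP => y2t; have := @two_downs t y1 y3 y2 (down2 t) d13.
    rewrite ![e t _]sym lt l2 l3 => /(_ y1t y3t y2t erefl erefl erefl).
    by rewrite eq_sym (negPf d12) (negPf d23).
  have [l l1 /andP[y2l tl]] : exists2 l, l != y1 & e y2 l && e t l.
    by apply: second_nbr; rewrite // 1?sym //; apply: lev_neq; nlia.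
  have [ll|ll] := eqVneq (lev l) (lev y2).
    have : 1 < ex y2 by apply: (@excess_side2 y2 l y1); rewrite // 1?sym.
    by have := budget2 d12; nlia.
  have st : 0 < ex t by apply: (@excess_side1 t l) => //; have := lev_adj y2l; have := lev_adj tl; nlia.
  have := budget3 (uniq3 d12 (adj_neq y1t) (lev_neq (_ : lev y2 != lev t))).
  by nlia.
move=> x1p x1q x2p x2q x3p x3q up uq lp lq l2 l3 lu.
have n12 : ~~ e x1 x2 by apply: (indep x1 x2 x3).
have n13 : ~~ e x1 x3.
  apply: (indep x1 x3 x2) => //; move: u3; rewrite /= !inE; case/and3P => /norP[a b] c _.
  by rewrite negb_or a b eq_sym c.
move: (u3); rewrite /= !inE !negb_or andbT => /andP[/andP[d12 d13] d23].
have [t [x1t x2t lt]] := @shared_child x1 x2 p q u pq d12 n12 x1p x1q x2p x2q up uq lp lq l2 lu.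
have [w [x1w x3w lw]] := @shared_child x1 x3 p q u pq d13 n13 x1p x1q x3p x3q up uq lp lq l3 lu.
have downt y : e y t -> lev y = lev x1 -> (y == x1) || (y == x2).
  by move=> yt ly; apply: (two_downs (down2 t)); rewrite // 1?[e t _]sym ?lt ?ly ?l2.
have downw y : e y w -> lev y = lev x1 -> (y == x1) || (y == x3).
  by move=> yw ly; apply: (two_downs (down2 w)); rewrite // 1?[e w _]sym ?lw ?ly ?l3.
have n2w : ~~ e x2 w.
  by apply/negP => /downw /(_ l2); rewrite eq_sym (negPf d12) (negPf d23).
have dtw : t != w by apply: contraNneq n2w => <-.
have ntw : ~~ e t w.
  apply/negP => tw.
  have st : 0 < ex t by apply: (@excess_side1 t w); rewrite ?lt.
  have sw : 0 < ex w by apply: (@excess_side1 w t); rewrite ?lt // sym.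
  have [l lt' /andP[x2l wl]] : exists2 l, l != t & e x2 l && e w l.
    by apply: second_nbr; rewrite // 1?[e w t]sym //; apply: lev_neq; nlia.
  have [ll|ll] := eqVneq (lev l) (lev w).
    have : 1 < ex w by apply: (@excess_side2 w l t); rewrite // 1?sym ?ll ?lt ?lw.
    by have := budget2 dtw; nlia.
  have s2 : 0 < ex x2 by apply: (@excess_side1 x2 l) => //; have := lev_adj x2l; have := lev_adj wl; nlia.
  have := budget3 (uniq3 (adj_neq x2t) (lev_neq (_ : lev x2 != lev w)) dtw).
  by nlia.
(* Downward, this neighbour would be [x2], which misses [w]; inside the level it costs three units;
   upward, [same_down] makes [x2] adjacent to [w]. *)
have [l lx1 /andP[tl wl]] : exists2 l, l != x1 & e t l && e w l.
  by apply: second_nbr; rewrite // sym.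
have [ll|ll] := eqVneq (lev l) (lev x1).
  have := downt l; rewrite sym tl (negPf lx1) => /(_ isT ll) /eqP l2E.
  by move: n2w; rewrite sym -l2E wl.
have [ll'|ll'] := eqVneq (lev l) (lev t).
  have : 1 < ex l by apply: (@excess_side2 l t w); rewrite // 1?sym ?ll' ?lt ?lw.
  have : 0 < ex t by apply: (@excess_side1 t l).
  by have := budget2 (adj_neq tl); nlia.
have lll : lev l = (lev t).+1 by have := lev_adj tl; nlia.
suff : e w x2 by rewrite sym (negPf n2w).
by apply: (@same_down l t w); rewrite // 1?sym ?lll ?lt ?lw ?l2.
Qed.

Hypothesis deg2 : degree e v = 2.

(** Both claims go through one induction. Two parents exhaust the previous level, which gives
    completeness; then three vertices of one level would share both parents and a grandparent,
    against [no_triple]. *)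
Lemma level_structure i :
  (forall x y z, lev x = i -> lev y = i -> lev z = i -> ~~ uniq [:: x; y; z]) /\
  (forall x y, lev x = i -> (lev y).+1 = i -> e x y).
Proof.
elim: i => [|[|i] [IH1 IH2]].
- split=> // x y z /eqP + /eqP; rewrite !(lev_root lay) => /eqP-> /eqP-> _.
  by rewrite /= inE eqxx.
- split=> [x y z /eqP + /eqP + /eqP|x y /eqP + [] /eqP].
    rewrite !lev1E => vx vy vz; apply/negP => u.
    have : 3 <= degree e v; last by rewrite deg2.
    rewrite /degree -[3]/(size [:: x; y; z]) -(card_uniqP u).
    by apply/subset_leq_card/subsetP => w; rewrite !inE => /or3P[]/eqP->.
  by rewrite lev1E (lev_root lay) sym => vx /eqP->.
have compl x y : lev x = i.+2 -> (lev y).+1 = i.+2 -> e x y.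
  move=> lx ly; have [|p [q [pq xp xq lp lq]]] := @two_parents x; first by nlia.
  have [<- //|py] := eqVneq p y; have [<- //|qy] := eqVneq q y.
  have /negP[] : ~~ uniq [:: p; q; y] by apply: IH1; nlia.
  exact: uniq3.
split=> // x y z lx ly lz; apply/negP => u.
have [|p [q [pq xp xq lp lq]]] := @two_parents x; first by nlia.
have [|w pw lw] := @parent p; first by nlia.
apply: (@no_triple x y z p q w u pq) => //; try (by apply: compl; nlia); try nlia.
  by rewrite sym.
by rewrite sym; apply: IH2; nlia.
Qed.

Lemma level_le2 x y z : lev y = lev x -> lev z = lev x -> uniq [:: x; y; z] -> False.
Proof. by move=> ly lz; apply/negP; apply: (proj1 (level_structure (lev x))). Qed.

Lemma level_complete x y : (lev y).+1 = lev x -> e x y.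
Proof. by apply: (proj2 (level_structure (lev x))). Qed.

(** Nonadjacent vertices of the last level would have a common child by [shared_child]; at level 1,
    their second common neighbour besides [v] would be a third vertex of that level. *)
Lemma top_adj x y : x != y -> lev x = lev y -> (forall z, lev z <= lev x) -> e x y.
Proof.
move=> xy lxy top; apply: contraT => nxy.
have [l0|l0] := posnP (lev x).
  by move/eqP: (l0); move/eqP: l0; rewrite {2}lxy !(lev_root lay) => /eqP xv /eqP yv; rewrite xv yv eqxx in xy.
have [l1|l1] := leqP (lev x) 1.
  have {l0}l1 : lev x = 1 by nlia.
  have [l lv /andP[xl yl]] : exists2 l, l != v & e x l && e y l.
    by apply: second_nbr; rewrite // sym -lev1E -?lxy l1.
  have ll : lev l = lev x.
    have := top l; rewrite -(lev_root lay) in lv; nlia.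
  by case: (@level_le2 x y l) => //; rewrite /= !inE negb_or xy (adj_neq xl) (adj_neq yl).
have [p [q [pq xp xq lp lq]]] := two_parents l1.
have [|u pu lu] := @parent p; first by nlia.
have yp : e y p by apply: level_complete; nlia.
have yq : e y q by apply: level_complete; nlia.
have uq : e u q by rewrite sym; apply: level_complete; nlia.
have lux : (lev u).+2 = lev x by nlia.
rewrite sym in pu.
have [t [_ _ lt]] := shared_child pq xy nxy xp xq yp yq pu uq lp lq (esym lxy) lux.
by have := top t; nlia.
Qed.

Lemma ladder_candle : X <= (odd #|T|).*2 ->
  (exists k, [/\ 2 <= k, #|T| = k.*2 & graph_iso e (@candle2 k)]) \/
  (exists k, [/\ 1 <= k, #|T| = k.*2.+1 & graph_iso e (@candle1 k)]).
Proof.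
move=> Xodd.
case: (arg_maxnP lev (erefl (xpredT v))) => x0 _ top0.
pose D := lev x0; have top x : lev x <= D by apply: top0.
have /card_gt0P[w vw] : 0 < degree e v by rewrite deg2.
have D1 : 0 < D by apply: leq_trans (top w); have := lev1E w; rewrite [e v w]vw => /eqP->.
have lev0 x y : lev x = 0 -> lev y = 0 -> x = y.
  by move=> /eqP + /eqP; rewrite !(lev_root lay) => /eqP-> /eqP.
have c0 : #|[pred x | lev x == 0]| = 1.
  by rewrite (eq_card (lev_root lay)) card1.
have cmid i : 0 < i -> i < D -> #|[pred x | lev x == i]| = 2.
  move=> i0 iD; have [x lx] := @level_inhabited x0 i.+1 iD.
  have [|p [q [pq xp xq lp lq]]] := @two_parents x; first by nlia.
  suff /eq_card-> : [pred x | lev x == i] =i pred2 p q by rewrite card2 pq.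
  move=> y; rewrite !inE; apply/eqP/orP => [ly|[]/eqP->]; try nlia.
  have [py|py] := eqVneq p y; [by left | have [qy|qy] := eqVneq q y; first by right].
  by case: (@level_le2 p q y); [nlia | nlia | exact: uniq3].
have cT : #|T| = D.*2.-1 + #|[pred x | lev x == D]|.
  rewrite (card_levels top); case: (D) D1 cmid => // d _ cmid.
  rewrite big_ord_recr big_ord_recl /= c0 (eq_bigr (fun=> 2)) => [|i _].
    by rewrite sum_nat_const card_ord; lia.
  by rewrite /bump /= add1n cmid // ltnS ltn_ord.
have adjacent x y : e x y -> lev x != lev y -> (lev x == (lev y).+1) || (lev y == (lev x).+1).
  by move=> /lev_adj; lia.
have complete x y : (lev x == (lev y).+1) || (lev y == (lev x).+1) -> e x y.
  by case/orP=> /eqP l; [|rewrite sym]; apply: level_complete.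
case: (pickP (fun y => (y != x0) && (lev y == D))) => [y /andP[yx0 /eqP ly]|single].
  have cD : #|[pred x | lev x == D]| = 2.
    suff /eq_card-> : [pred x | lev x == D] =i pred2 x0 y by rewrite card2 eq_sym yx0.
    move=> z; rewrite !inE; apply/eqP/orP => [lz|[]/eqP->] //.
    have [xz|xz] := eqVneq x0 z; [by left | have [yz|yz] := eqVneq y z; first by right].
    by case: (@level_le2 x0 y z) => //; apply: uniq3; rewrite // eq_sym.
  have cT' : #|T| = D.*2.+1 by nlia.
  right; exists D; split=> //.
  have [||f [bf fl]] := @level_labelling T lev _ cT' _ _ lev0 level_le2.
  - by move=> x; have := top x; nlia.
  - by move=> x z _ _; have := top x; nlia.
  exists f; split=> // x z; rewrite /candle1 !fl; apply/idP/or3P.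
    move=> xz; have [lxz|/(adjacent _ _ xz)/orP[]] := eqVneq (lev x) (lev z); [|by constructor 1|by constructor 2].
    have xy0 : e x0 y by apply: top_adj; rewrite // eq_sym.
    have s0 : 0 < ex x0 by apply: (@excess_side1 x0 y).
    have sy : 0 < ex y by apply: (@excess_side1 y x0); rewrite // sym.
    have sx : 0 < ex x by apply: (@excess_side1 x z).
    (* The edge between [x0] and [y] spends the whole budget of 2, so no edge lies inside a lower
       level. *)
    have lxD : lev x = D.
      apply/eqP/negPn/negP => nD.
      have := @budget3 x x0 y; rewrite uniq3 // 1?eq_sym //; try by apply: lev_neq; nlia.
      by move=> /(_ isT); nlia.
    constructor 3; rewrite -lxz lxD eqxx (inj_eq (bij_inj bf)).
    exact: (adj_neq xz).
  case=> [h|h|/and3P[/eqP lx /eqP lz]]; try by apply: complete; rewrite h ?orbT.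
  rewrite (inj_eq (bij_inj bf)) => xz; apply: top_adj; rewrite // lx //.
have cD : #|[pred x | lev x == D]| = 1.
  rewrite (@eq_card1 _ x0) // => z; rewrite !inE; have := single z.
  by have [->|] := eqVneq z x0; rewrite ?eqxx.
have cT' : #|T| = D.*2 by nlia.
left; exists D.
have D2 : 1 < D.
  rewrite ltn_neqAle D1 andbT eq_sym; apply/eqP => D1'.
  have : degree e v = 1; last by rewrite deg2.
  by rewrite /degree -cD D1'; apply: eq_card => z; rewrite !inE lev1E.
split=> //.
have X0 : X = 0 by move: Xodd; rewrite cT' odd_double; nlia.
have [||f [bf fl]] := @level_labelling T lev _ cT' _ _ lev0 level_le2.
- by move=> x; have := top x; nlia.
- move=> x z xz lxz; have := top x; rewrite leq_eqVlt => /orP[/eqP lx|]; last by nlia.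
  have := single z; have := single x; rewrite lxz lx eqxx !andbT => /negbFE/eqP xE /negbFE/eqP zE.
  by rewrite xE zE eqxx in xz.
exists f; split=> // x z; rewrite /candle2 !fl; apply/idP/idP => [xz|]; last exact: complete.
apply: adjacent => //; apply/eqP => lxz.
have : 0 < ex x by apply: (@excess_side1 x z).
by have := budget2 (adj_neq xz); nlia.
Qed.

End Ladder.

(** * Root of degree three: the cube *)

Section Cube.
Hypothesis deg_ge3 : forall x, 3 <= degree e x.
Hypothesis Xodd : X <= (odd #|T|).*2.+2.
Hypothesis odd_side : odd #|T| -> exists x y, e x y /\ lev y = lev x.

Lemma card_listed (s : seq T) : uniq s -> (forall x, x \in s) -> #|T| = size s.
Proof. by move=> us sT; rewrite -(card_uniqP us); apply: eq_card => x; rewrite sT. Qed.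

Lemma excess_le4 : X <= 4. Proof. by move: Xodd; case: (odd _); nlia. Qed.

Lemma excess_gt2_odd : 2 < X -> odd #|T|.
Proof. by move: Xodd; case: (odd _) => //= X2 /leq_trans/(_ X2). Qed.

(** For odd order, an edge inside a level already uses two of the four units. So at most one vertex
    has three downward neighbours and none has four. *)
Lemma down_excess_le2 : \sum_x (down e lev x - 2).*2 <= 2.
Proof.
have XE : X = \sum_x side e lev x + \sum_x (down e lev x - 2).*2 by rewrite -big_split.
have [/[dup] oT /odd_side[x [y [xy lxy]]]|eT] := boolP (odd #|T|); last first.
  by move: Xodd; rewrite (negPf eT) XE; nlia.
have s1 p q : e p q -> lev q = lev p -> 0 < side e lev p.
  by move=> pq lpq; apply/card_gt0P; exists q; rewrite !inE pq lpq eqxx.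
suff : 2 <= \sum_x side e lev x by move: excess_le4; rewrite XE; nlia.
rewrite (bigD1 x) //= (bigD1 y) /=; last by rewrite eq_sym adj_neq.
by have := s1 _ _ xy lxy; have := s1 y x; rewrite sym => /(_ xy (esym lxy)); nlia.
Qed.

Lemma down_le3 x : down e lev x <= 3.
Proof. by have := down_excess_le2; rewrite (bigD1 x) //=; nlia. Qed.

Lemma down3_unique x y : 2 < down e lev x -> 2 < down e lev y -> x = y.
Proof.
move=> dx dy; apply/eqP/negPn/negP => xy.
have := down_excess_le2; rewrite (bigD1 x) //= (bigD1 y) /=; last by rewrite eq_sym.
nlia.
Qed.

Lemma down_card x s : uniq s -> all (fun y => e x y && ((lev y).+1 == lev x)) s ->
  size s <= down e lev x.
Proof.
move=> us /allP a; rewrite /down -(card_uniqP us).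
by apply/subset_leq_card/subsetP => y /a.
Qed.

(** At least three neighbours, none of them upward, are too many for the two free downward ones. *)
Lemma leaf_excess w : 1 < lev w -> (forall y, e w y -> lev y <= lev w) -> 0 < ex w.
Proof.
move=> l2 leaf; suff : degree e w <= side e lev w + down e lev w.
  by have := deg_ge3 w; rewrite /excess; nlia.
rewrite /degree /side /down !card_pred_sum -big_split /=; apply: leq_sum => y _.
have [wy|//] := boolP (e w y).
by have := leaf y wy; have := lev_adj wy; case: eqP; case: eqP; nlia.
Qed.

Lemma third_nbr x p q : exists r, [/\ e x r, r != p & r != q].
Proof.
have [r /and3P[]|none] := pickP [pred r | [&& e x r, r != p & r != q]]; first by exists r.
have : degree e x <= #|pred2 p q|.
  apply/subset_leq_card/subsetP => r; rewrite !inE => xr.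
  by have := none r; rewrite /= xr; case: eqP; case: eqP.
by have := deg_ge3 x; rewrite card2; case: (p != q); nlia.
Qed.

(** The names are ordered; swap and rotation below generate all permutations, so that later cases
    are treated up to symmetry. *)
Definition root_nbrs a b c := uniq [:: a; b; c] /\ forall x, (lev x == 1) = (x \in [:: a; b; c]).

Lemma root_nbrs_swap a b c : root_nbrs a b c -> root_nbrs b a c.
Proof.
have p : perm_eq [:: b; a; c] [:: a; b; c] by rewrite (perm_catCA [:: b] [:: a] [:: c]).
by case=> u N; split=> [|x]; rewrite ?(perm_uniq p) ?(perm_mem p).
Qed.

Lemma root_nbrs_rot a b c : root_nbrs a b c -> root_nbrs b c a.
Proof.
have p : perm_eq [:: b; c; a] [:: a; b; c] by rewrite (perm_catC [:: b; c] [:: a]).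
by case=> u N; split=> [|x]; rewrite ?(perm_uniq p) ?(perm_mem p).
Qed.

Lemma root_nbrs_lev a b c : root_nbrs a b c -> [/\ lev a = 1, lev b = 1 & lev c = 1].
Proof. by case=> u N; split; apply/eqP; rewrite N !inE eqxx ?orbT. Qed.

Lemma root_nbrs_neq a b c : root_nbrs a b c -> [/\ a != b, a != c & b != c].
Proof. by case=> /=; rewrite !inE negb_or andbT => /andP[/andP[-> ->] ->]. Qed.

Lemma root_nbrsP a b c x : root_nbrs a b c -> lev x = 1 -> [\/ x = a, x = b | x = c].
Proof. by case=> u N /eqP; rewrite N !inE => /or3P[]/eqP->; [constructor 1|constructor 2|constructor 3]. Qed.

Lemma lev_v : lev v = 0. Proof. by apply/eqP; rewrite (lev_root lay). Qed.

Lemma lev0_v x : lev x = 0 -> x = v.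
Proof. by move/eqP; rewrite (lev_root lay) => /eqP. Qed.

Lemma adj_v x : lev x = 1 -> e x v.
Proof. by rewrite sym -lev1E => ->. Qed.

Lemma excess_rest4 a b x y w : uniq [:: a; b; x; y] -> 3 < ex a + ex b + ex x + ex y ->
  0 < ex w -> w \in [:: a; b; x; y].
Proof.
move=> u s4 ew; apply/negPn/negP => wn.
have := @budget5 w a b x y; rewrite cons_uniq wn u => /(_ isT).
by have := excess_le4; nlia.
Qed.

Lemma excess_rest3 a b x w : uniq [:: a; b; x] -> 3 < ex a + ex b + ex x ->
  0 < ex w -> w \in [:: a; b; x].
Proof.
move=> u s4 ew; apply/negPn/negP => wn.
have := @budget4 w a b x; rewrite cons_uniq wn u => /(_ isT).
by have := excess_le4; nlia.
Qed.

(** The path spends four units in level 1, while a farthest vertex of level at least 2 would have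
    excess. So only [v], [a], [b], [c] remain, an even order that allows two units. *)
Lemma no_root_path a b c : root_nbrs a b c -> e a b -> e a c -> False.
Proof.
move=> N ab ac; have [la lb lc] := root_nbrs_lev N; have [dab dac dbc] := root_nbrs_neq N.
have sa : 1 < ex a by apply: (@excess_side2 a b c); nlia || by [].
have sb : 0 < ex b by apply: (@excess_side1 b a); rewrite 1?sym; nlia || by [].
have sc : 0 < ex c by apply: (@excess_side1 c a); rewrite 1?sym; nlia || by [].
have low x : lev x <= 1.
  case: (arg_maxnP lev (erefl (xpredT v))) => w _ top.
  suff lw : lev w <= 1 by apply: leq_trans (top x isT) lw.
  rewrite leqNgt; apply/negP => lw.
  have := @excess_rest3 a b c w (uniq3 dab dac dbc).
  have -> : w \in [:: a; b; c] = false by rewrite -(proj2 N); nlia.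
  have := leaf_excess lw (fun y _ => top y isT); nlia.
have : odd #|T| by apply: excess_gt2_odd; have := budget3 (uniq3 dab dac dbc); nlia.
rewrite (@card_listed [:: v; a; b; c]) //.
  by apply: uniq4 => //; apply: lev_neq; rewrite lev_v; nlia.
move=> x; rewrite in_cons -(proj2 N) -(lev_root lay).
by have := low x; case: (lev x) => [|[]].
Qed.

(** Since [s] misses [c], the second common neighbour of [x] and [s] besides [r] cannot be in level
    1, so it lies in the level of [x]. *)
Lemma twin_side r s c x : root_nbrs r s c -> ~~ e s c -> e r s ->
  e x r -> lev x = 2 -> ~~ e x s -> exists l, [/\ e x l, lev l = lev x & e s l].
Proof.
move=> N sc rs xr lx xs; have [lr ls lc] := root_nbrs_lev N.
have [l lr' /andP[sl xl]] : exists2 l, l != r & e s l && e x l.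
  by apply: second_nbr; rewrite // 1?sym //; apply: lev_neq; nlia.
exists l; split=> //; have [l1|] := eqVneq (lev l) 1; last first.
  by have := lev_adj sl; have := lev_adj xl; nlia.
case: (root_nbrsP N l1) => lE; move: sl lr' sc; rewrite lE ?eqxx ?irr //.
by move=> ->.
Qed.

Lemma root_common_child a b c : root_nbrs a b c -> ~~ e a b -> ~~ (e a c && e b c) ->
  exists x, [/\ lev x = 2, e x a & e x b].
Proof.
move=> N ab nc; have [la lb lc] := root_nbrs_lev N; have [dab dac dbc] := root_nbrs_neq N.
have [l lv /andP[al bl]] : exists2 l, l != v & e a l && e b l.
  by apply: second_nbr => //; apply: adj_v.
exists l; rewrite ![e l _]sym; split=> //.
have [l1|l1] := eqVneq (lev l) 1.
  by case: (root_nbrsP N l1) => lE; move: al bl nc ab; rewrite lE ?irr // => -> ->.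
have l0 : lev l <> 0 by move/lev0_v => lE; rewrite lE eqxx in lv.
by have := lev_adj al; nlia.
Qed.

(** Here [a], [b] and [z] use all four units. A further child [x] of [c] needs [a] or [b] as second
    parent; it misses the other one, and [twin_side] gives it excess. *)
Lemma no_root_edge_triple a b c z : root_nbrs a b c -> e a b -> ~~ e a c -> ~~ e b c ->
  lev z = 2 -> e z a -> e z b -> e z c -> False.
Proof.
move=> N ab ac bc lz za zb zc.
have [la lb lc] := root_nbrs_lev N; have [dab dac dbc] := root_nbrs_neq N.
have sa : 0 < ex a by apply: (@excess_side1 a b); nlia || by [].
have sb : 0 < ex b by apply: (@excess_side1 b a); rewrite 1?sym; nlia || by [].
have sz : 1 < ex z by apply: (@excess_down3 z a b c); rewrite ?uniq3 ?lz ?la ?lb ?lc.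
have uz : uniq [:: a; b; z] by apply: uniq3 => //; apply: lev_neq; nlia.
have rest := @excess_rest3 a b z _ uz; have {}rest w : 0 < ex w -> w \in [:: a; b; z].
  by apply: rest; nlia.
have [x [cx xv xz]] := third_nbr c v z.
have lx : lev x = 2.
  have [l1|l1] := eqVneq (lev x) 1.
    by case: (root_nbrsP N l1) => lE; move: cx ac bc; rewrite lE ?irr // sym => ->.
  have l0 : lev x <> 0 by move/lev0_v => lE; rewrite lE eqxx in xv.
  by have := lev_adj cx; nlia.
have x0 : ~~ (0 < ex x).
  by apply/negP => /rest; rewrite !inE (negPf xz) orbF => /orP[]/eqP E; move: lx; rewrite E; nlia.
have [|p [q [pq xp xq lp lq]]] := @two_parents x; first by nlia.
have d2 : down e lev x <= 2 by apply: excess_le1_down; nlia.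
have K r s : root_nbrs r s c -> ~~ e s c -> e r s -> e x r -> False.
  move=> N' sc rs xr; have [dl1 dl2 dl3] := root_nbrs_neq N'; have [l1 l2 l3] := root_nbrs_lev N'.
  have xs : ~~ e x s.
    apply/negP => xs; have := @two_downs x r c s d2; rewrite [e x c]sym lx l1 l2 l3.
    by move=> /(_ dl2 xr cx xs erefl erefl erefl); rewrite eq_sym (negPf dl1) (negPf dl3).
  have [l [xl ll _]] := twin_side N' sc rs xr lx xs.
  by case/negP: x0; apply: (@excess_side1 x l).
have lp1 : lev p = 1 by nlia.
have lq1 : lev q = 1 by nlia.
have Ka : e x a -> False by apply: (K a b).
have Kb : e x b -> False by apply: (K b a (root_nbrs_swap N) ac); rewrite sym.
case: (root_nbrsP N lp1) => E; rewrite E in xp pq => //.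
case: (root_nbrsP N lq1) => E'; rewrite E' in xq pq => //.
by rewrite eqxx in pq.
Qed.

(** In the remaining case [c] misses [a] and [b]. Children [x] of [a], [c] and [y] of [b], [c] get
    side neighbours by [twin_side], so [a], [b], [x], [y] use all four units. Top vertices have
    excess, which confines the graph to six vertices, an even order that allows two units. *)
Lemma no_root_edge a b c : root_nbrs a b c -> e a b -> False.
Proof.
move=> N ab; have N' := root_nbrs_swap N.
have [ac|ac] := boolP (e a c); first exact: (no_root_path N ab ac).
have [bc|bc] := boolP (e b c); first by apply: (no_root_path N' _ bc); rewrite sym.
have [la lb lc] := root_nbrs_lev N; have [dab dac dbc] := root_nbrs_neq N.
have notriple := no_root_edge_triple N ab ac bc.
have ba : e b a by rewrite sym.
have Nac : root_nbrs a c b by apply: root_nbrs_swap (root_nbrs_rot (root_nbrs_rot N)).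
have [|x [lx xa xc]] := root_common_child Nac ac; first by rewrite negb_and [e c b]sym bc orbT.
have [|y [ly yb yc]] := root_common_child (root_nbrs_rot N) bc.
  by rewrite negb_and [e c a]sym ac orbT.
have xb : ~~ e x b by apply/negP => xb; apply: (notriple x).
have ya : ~~ e y a by apply/negP => ya; apply: (notriple y).
have [u [xu lu bu]] := twin_side N bc ab xa lx xb.
have [u' [yu' lu' au']] := twin_side N' ac ba yb ly ya.
have sa : 0 < ex a by apply: (@excess_side1 a b); nlia || by [].
have sb : 0 < ex b by apply: (@excess_side1 b a); nlia || by [].
have sx : 0 < ex x by apply: (@excess_side1 x u).
have sy : 0 < ex y by apply: (@excess_side1 y u').
have xy : x != y by apply: contraNneq xb => ->.
have u4 : uniq [:: a; b; x; y] by apply: uniq4 => //; apply: lev_neq; nlia.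
have rest w : 0 < ex w -> w \in [:: a; b; x; y] by apply: excess_rest4 => //; nlia.
have rest2 w : 1 < lev w -> 0 < ex w -> w \in [:: x; y].
  by move=> lw /rest; rewrite !inE => /or4P[]/eqP E; rewrite E ?eqxx ?orbT // in lw *; nlia.
case: (arg_maxnP lev (erefl (xpredT v))) => w _ top.
have lw : 1 < lev w by have := top x isT; rewrite /= => h; nlia.
have top2 z : lev z <= 2.
  have := rest2 w lw (leaf_excess lw (fun z _ => top z isT)); rewrite !inE.
  by have := top z isT; rewrite /= => h /orP[]/eqP E; rewrite E in h; nlia.
have : odd #|T| by apply: excess_gt2_odd; have := budget4 u4; nlia.
rewrite (@card_listed [:: v; a; b; c; x; y]) //.
  rewrite /= !inE !negb_or xy dab dac dbc /= !andbT.
  by rewrite !(lev_neq (_ : lev _ != lev _)) ?lev_v ?la ?lb ?lc ?lx ?ly.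
move=> z; have [l0|] := posnP (lev z); first by rewrite (lev0_v l0) !inE eqxx.
rewrite leq_eqVlt => /orP[/eqP/esym l1|l2].
  by case: (root_nbrsP N l1) => ->; rewrite !inE eqxx ?orbT.
suff : z \in [:: x; y] by rewrite !inE => /orP[]->; rewrite ?orbT.
apply: rest2 => //; apply: leaf_excess => // t _; apply: leq_trans (top2 t) l2.
Qed.

Lemma root_indep a b c x : root_nbrs a b c -> e a x -> lev x != 1.
Proof.
move=> N ax; apply/eqP => /(root_nbrsP N) [] xE; move: ax; rewrite xE ?irr //.
  exact: (no_root_edge N).
by apply: no_root_edge; apply: root_nbrs_swap (root_nbrs_rot (root_nbrs_rot N)).
Qed.

Definition over_pair a b c x := [/\ lev x = 2, e x a, e x b & ~~ e x c].

Lemma over_pair_sym a b c x : over_pair a b c x -> over_pair b a c x.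
Proof. by case. Qed.

Lemma over_pair_cases a b c x : root_nbrs a b c -> lev x = 2 -> ~~ [&& e x a, e x b & e x c] ->
  [\/ over_pair a b c x, over_pair a c b x | over_pair b c a x].
Proof.
move=> N lx; have [|p [q [pq xp xq lp lq]]] := @two_parents x; first by rewrite lx.
have lp1 : lev p = 1 by nlia.
have lq1 : lev q = 1 by nlia.
case: (root_nbrsP N lp1) xp pq => ->; case: (root_nbrsP N lq1) xq => ->; rewrite ?eqxx //.
- by move=> xb xa _; rewrite xa xb /= => xc; constructor 1.
- by move=> xc xa _; rewrite xa xc andbT /= => xb; constructor 2.
- by move=> xa xb _; rewrite xa xb /= => xc; constructor 1.
- by move=> xc xb _; rewrite xb xc !andbT => xa; constructor 3.
- by move=> xa xc _; rewrite xa xc andbT /= => xb; constructor 2.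
- by move=> xb xc _; rewrite xb xc !andbT => xa; constructor 3.
Qed.

(* The level 2 neighbour of [y] provided by a second common neighbour of [y]
   and the root neighbour [b] it misses. *)
Lemma over_pair_side a b c x y : root_nbrs a b c -> over_pair a b c x ->
  over_pair a c b y -> e x y -> exists u, [/\ e y u, u != x & lev u = 2].
Proof.
move=> N [lx xa xb xc] [ly ya yc yb] xy; have [la lb lc] := root_nbrs_lev N.
have [u ux /andP[bu yu]] : exists2 u, u != x & e b u && e y u.
  by apply: second_nbr; rewrite 1?[e b y]sym 1?[e b x]sym 1?[e y x]sym //; apply: lev_neq; nlia.
exists u; split=> //.
have := root_indep (root_nbrs_swap N) bu.
by have := lev_adj bu; have := lev_adj yu; nlia.
Qed.

Lemma over_pair_neq a b c x y : over_pair a b c x -> over_pair a c b y -> x != y.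
Proof. by case=> _ _ xb _ [_ _ _ yb]; apply: contraNneq yb => <-. Qed.

(** Besides [a], no root neighbour is adjacent to both. A common neighbour in level 3 with only two
    downward neighbours would make [y] adjacent to [b] by [same_down]. *)
Lemma over_pair_link a b c x y : root_nbrs a b c -> over_pair a b c x ->
  over_pair a c b y -> ~~ e x y ->
  exists z, [/\ e x z, e y z & lev z = 2 \/ lev z = 3 /\ 2 < down e lev z].
Proof.
move=> N /[dup] xP [lx xa xb xc] /[dup] yP [ly ya yc yb] xy.
have dxy := over_pair_neq xP yP; have [la lb lc] := root_nbrs_lev N.
have [l la' /andP[xl yl]] : exists2 l, l != a & e x l && e y l by apply: second_nbr.
exists l; split=> //; have [ll1 ll2] := lev_adj xl.
have [l1|l1] := eqVneq (lev l) 1.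
  by case: (root_nbrsP N l1) => lE; move: la' xl yl; rewrite lE ?eqxx ?(negPf xc) ?(negPf yb).
have [l2|l2] := eqVneq (lev l) 2; [by left | right].
have l3 : lev l = 3 by nlia.
split=> //; rewrite ltnNge; apply/negP => d2.
case/negP: yb; apply: (@same_down l x y b d2 dxy); rewrite ?lx ?ly ?l3 ?lb // sym //.
Qed.

(** The vertex [z] costs two units and is the only one with three downward neighbours. An edge
    between [x] and [y], or else their link in level 2, costs more than the two units left. *)
Lemma no_full_child_pair a b c x y z : root_nbrs a b c -> over_pair a b c x ->
  over_pair a c b y -> lev z = 2 -> e z a -> e z b -> e z c -> False.
Proof.
move=> N /[dup] xP [lx xa xb xc] /[dup] yP [ly ya yc yb] lz za zb zc.
have [la lb lc] := root_nbrs_lev N; have [dab dac dbc] := root_nbrs_neq N.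
have dxy := over_pair_neq xP yP.
have dzx : z != x by apply: contraNneq xc => <-.
have dzy : z != y by apply: contraNneq yb => <-.
have uz : uniq [:: a; b; c] by case: N.
have sz : 1 < ex z by apply: (@excess_down3 z a b c); rewrite ?lz ?la ?lb ?lc.
have dz : 2 < down e lev z.
  by apply: (@down_card z [:: a; b; c]); rewrite //= za zb zc lz la lb lc.
have b3 := budget3 (uniq3 dzx dzy dxy).
have [xy|xy] := boolP (e x y).
  have [u [yu ux lu]] := over_pair_side N xP yP xy.
  have s2 : 1 < ex y by apply: (@excess_side2 y u x); rewrite ?lu ?lx // sym.
  have s1 : 0 < ex x by apply: (@excess_side1 x y); rewrite ?lx.
  by have := excess_le4; nlia.
have [l [xl yl [ll|[ll dl]]]] := over_pair_link N xP yP xy; last first.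
  by have := down3_unique dz dl => zl; move: ll; rewrite -zl lz.
have sx : 0 < ex x by apply: (@excess_side1 x l); rewrite ?lx.
have sy : 0 < ex y by apply: (@excess_side1 y l); rewrite ?ly.
have [zl|zl] := eqVneq z l.
  have : 3 < ex z.
    by apply: (@excess_down3_side2 z a b c x y); rewrite ?lz ?la ?lb ?lc ?lx ?ly // zl sym.
  by have := excess_le4; nlia.
have sl : 1 < ex l by apply: (@excess_side2 l x y); rewrite ?ll ?lx ?ly // sym.
have := budget4 (uniq4 dzx dzy zl dxy (adj_neq xl) (adj_neq yl)).
by have := excess_le4; nlia.
Qed.

Lemma root_other_child a b c z : root_nbrs a b c -> lev z = 2 ->
  exists x, [/\ x != z, lev x = 2 & e x a].
Proof.
move=> N lz; have [la lb lc] := root_nbrs_lev N.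
have [x [ax xv xz]] := third_nbr a v z; exists x; rewrite sym; split=> //.
have := root_indep N ax; have l0 : lev x <> 0 by move/lev0_v => lE; rewrite lE eqxx in xv.
by have := lev_adj ax; nlia.
Qed.

Lemma no_full_child a b c z : root_nbrs a b c -> lev z = 2 ->
  e z a -> e z b -> e z c -> False.
Proof.
move=> N lz za zb zc.
have full a' b' c' y : root_nbrs a' b' c' -> e z a' -> e z b' -> e z c' -> y != z -> lev y = 2 ->
    ~~ [&& e y a', e y b' & e y c'].
  move=> N' za' zb' zc' yz ly; apply: contra yz => /and3P[ya yb yc].
  have [l1 l2 l3] := root_nbrs_lev N'.
  apply/eqP/down3_unique; apply: (@down_card _ [:: a'; b'; c']); rewrite ?(proj1 N') //=.
    by rewrite ya yb yc ly l1 l2 l3.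
  by rewrite za' zb' zc' lz l1 l2 l3.
(* [x] misses [c'], so another child of [c'] shares a single root neighbour with [x]. *)
have K a' b' c' x : root_nbrs a' b' c' -> e z a' -> e z b' -> e z c' ->
    over_pair a' b' c' x -> False.
  move=> N' za' zb' zc' xP; have [y [yz ly yc]] := root_other_child (root_nbrs_rot (root_nbrs_rot N')) lz.
  case: (over_pair_cases N' ly (full _ _ _ _ N' za' zb' zc' yz ly)) => yP.
  - by case: yP => _ _ _; rewrite yc.
  - exact: (no_full_child_pair N' xP yP lz).
  - exact: (no_full_child_pair (root_nbrs_swap N') (over_pair_sym xP) yP lz).
have [x [xz lx xa]] := root_other_child N lz.
case: (over_pair_cases N lx (full _ _ _ _ N za zb zc xz lx)) => xP.
- exact: (K a b c x).
- by apply: (K a c b x) => //; apply: root_nbrs_swap (root_nbrs_rot (root_nbrs_rot N)).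
- by apply: (K b c a x) => //; apply: root_nbrs_rot.
Qed.

(** By [over_pair_side] from both ends, an edge gives [x] and [y] excess 2 each, and the extra
    neighbour of [y] a fifth unit. *)
Lemma over_pair_nonadj a b c x y : root_nbrs a b c -> over_pair a b c x ->
  over_pair a c b y -> ~~ e x y.
Proof.
move=> N xP yP; apply/negP => xy.
have [u [yu ux lu]] := over_pair_side N xP yP xy.
have Nac : root_nbrs a c b by apply: root_nbrs_swap (root_nbrs_rot (root_nbrs_rot N)).
have yx : e y x by rewrite sym.
have [w [xw wy lw]] := over_pair_side Nac yP xP yx.
have [lx _ _ _] := xP; have [ly _ _ _] := yP.
have sx : 1 < ex x by apply: (@excess_side2 x y w); rewrite ?lx ?ly ?lw // eq_sym.
have sy : 1 < ex y by apply: (@excess_side2 y u x); rewrite ?lx ?ly ?lu.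
have su : 0 < ex u by apply: (@excess_side1 u y); rewrite ?lu ?ly // sym.
have := budget3 (uniq3 (adj_neq xy) (_ : x != u) (adj_neq yu)); rewrite eq_sym ux => /(_ isT).
by have := excess_le4; nlia.
Qed.

(** If the link [z] were in level 2, then [x], [y], [z] would use all four units; but the link
    between [x] and [w] puts excess on [w] or on a vertex of level 3. *)
Lemma over_pair_apex a b c x y w : root_nbrs a b c -> over_pair a b c x ->
  over_pair a c b y -> over_pair b c a w ->
  exists z, [/\ e x z, e y z, lev z = 3 & 2 < down e lev z].
Proof.
move=> N xP yP wP.
have [z [xz yz [lz|[lz dz]]]] := over_pair_link N xP yP (over_pair_nonadj N xP yP); last by exists z.
have N' := root_nbrs_swap N; have xP' := over_pair_sym xP.
have xw := over_pair_nonadj N' xP' wP.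
have [lx _ _ _] := xP; have [ly _ _ _] := yP; have [lw _ _ _] := wP.
have dxy := over_pair_neq xP yP.
have sx : 0 < ex x by apply: (@excess_side1 x z); rewrite ?lx.
have sy : 0 < ex y by apply: (@excess_side1 y z); rewrite ?ly.
have sz : 1 < ex z by apply: (@excess_side2 z x y); rewrite ?lx ?ly ?lz // sym.
have zw : z != w by apply: contraNneq xw => <-.
have rest u : 0 < ex u -> u \in [:: x; y; z].
  by apply: excess_rest3; [apply: uniq3 => //; apply: adj_neq | nlia].
have wn : w \notin [:: x; y; z].
  rewrite !inE !negb_or [w == z]eq_sym zw andbT ![w == _]eq_sym (over_pair_neq xP' wP).
  by apply: (@over_pair_neq c a b) => //; apply: over_pair_sym.
have [t [xt wt [lt|[lt dt]]]] := over_pair_link N' xP' wP xw.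
  by case/negP: wn; apply: rest; apply: (@excess_side1 w t); rewrite ?lw.
have : 0 < ex t by rewrite /excess; nlia.
by move/rest; rewrite !inE => /or3P[]/eqP E; move: lt; rewrite E ?lx ?ly ?lz.
Qed.

Lemma over_pair_exists a b c : root_nbrs a b c -> exists x, over_pair a b c x.
Proof.
move=> N.
have ab : ~~ e a b by apply/negP; apply: no_root_edge N.
have ac : ~~ e a c.
  by apply/negP; apply: no_root_edge (root_nbrs_swap (root_nbrs_rot (root_nbrs_rot N))).
have [|x [lx xa xb]] := root_common_child N ab; first by rewrite (negPf ac).
by exists x; split=> //; apply/negP; apply: no_full_child N lx xa xb.
Qed.

(** The three pairs of root neighbours have children [x], [y], [w], whose apexes coincide because
    only one vertex has three downward neighbours. The levels then have sizes 1, 3, 3, 1. *)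
Lemma cube_of_root_nbrs a b c : root_nbrs a b c -> graph_iso e Q3.
Proof.
move=> N.
have Nac : root_nbrs a c b := root_nbrs_swap (root_nbrs_rot (root_nbrs_rot N)).
have Nbc : root_nbrs b c a := root_nbrs_rot N.
have [x xP] := over_pair_exists N; have [y yP] := over_pair_exists Nac.
have [w wP] := over_pair_exists Nbc.
have [la lb lc] := root_nbrs_lev N; have [dab dac dbc] := root_nbrs_neq N.
have [z [xz yz lz dz]] := over_pair_apex N xP yP wP.
have apex t : 2 < down e lev t -> t = z by move=> dt; apply: down3_unique.
have [t [_ wt _ dt]] := over_pair_apex (root_nbrs_swap N) (over_pair_sym xP) wP yP.
have wz : e w z by rewrite -(apex t dt).
have dxy := over_pair_neq xP yP.
have dxw := over_pair_neq (over_pair_sym xP) wP.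
have dyw := over_pair_neq (over_pair_sym yP) (over_pair_sym wP).
have [lx xa xb xc] := xP; have [ly ya yc yb] := yP; have [lw wb wc wa] := wP.
have three u : e u z -> lev u = 2 -> u \in [:: x; y; w].
  move=> uz lu; apply/negPn/negP => un.
  have : 4 <= down e lev z; last by have := down_le3 z; nlia.
  apply: (@down_card z [:: u; x; y; w]); first by rewrite cons_uniq un uniq3.
  by rewrite /= ![e z _]sym uz xz yz wz lu lx ly lw lz.
have lev2 u : lev u = 2 -> u \in [:: x; y; w].
  move=> lu; apply: three => //.
  have nfull : ~~ [&& e u a, e u b & e u c] by apply/and3P => -[]; apply: no_full_child N lu.
  case: (over_pair_cases N lu nfull) => uP.
  - by have [s [us _ _ ds]] := over_pair_apex N uP yP wP; rewrite -(apex s ds).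
  - by have [s [_ us _ ds]] := over_pair_apex N xP uP wP; rewrite -(apex s ds).
  - have [s [_ us _ ds]] := over_pair_apex (root_nbrs_swap N) (over_pair_sym xP) uP yP.
    by rewrite -(apex s ds).
(* If [u] had only two downward neighbours, these would have the same root neighbours by
   [same_down], but [x], [y], [w] lie over different pairs. *)
have lev3 u : lev u = 3 -> u = z.
  move=> lu; apply: apex; rewrite ltnNge; apply/negP => d2.
  have [|p [q [pq up uq lp lq]]] := @two_parents u; first by rewrite lu.
  have lp2 : lev p = 2 by nlia.
  have lq2 : lev q = 2 by nlia.
  have same r : lev r = 1 -> e p r -> e q r.
    by move=> lr; move=> pr; apply: (@same_down u p q r d2); rewrite // ?lr ?lp2.
  have same' r : lev r = 1 -> e q r -> e p r.
    by move=> lr; move=> pr; apply: (@same_down u q p r d2); rewrite // ?lr ?lq2 1?eq_sym.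
  have := lev2 p lp2; have := lev2 q lq2; rewrite !inE.
  move: pq (same _ la) (same _ lb) (same _ lc) (same' _ la) (same' _ lb) (same' _ lc).
  by move=> pq sa sb sc sa' sb' sc' /or3P[]/eqP qE /or3P[]/eqP pE; move: pq sa sb sc sa' sb' sc';
    rewrite qE pE ?eqxx // ?xa ?xb ?ya ?yc ?wb ?wc ?(negPf xc) ?(negPf yb) ?(negPf wa);
    do ?[by move/(_ isT) | move=> _].
have top u : lev u <= 3.
  rewrite leqNgt; apply/negP => /level_inhabited[s ls].
  have [|p [q [pq sp sq lp lq]]] := @two_parents s; first by rewrite ls.
  have pz : p = z by apply: lev3; nlia.
  have qz : q = z by apply: lev3; nlia.
  by rewrite pz qz eqxx in pq.
(* Positions in binary are subsets of the root neighbours: bits 0, 1, 2 stand for [a], [b], [c], the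
   pairs are [x], [y], [w], and [z] is the full set. *)
pose s := [:: v; a; b; x; c; y; w; z].
have us : uniq s.
  rewrite /= !inE !negb_or dab dac dbc dxy dxw dyw /= !andbT.
  by rewrite !(lev_neq (_ : lev _ != lev _)) ?lev_v ?la ?lb ?lc ?lx ?ly ?lw ?lz.
have sT u : u \in s.
  have := top u; rewrite leq_eqVlt => /orP[/eqP/lev3->|]; first by rewrite !inE eqxx ?orbT.
  rewrite ltnS leq_eqVlt => /orP[/eqP/lev2|].
    by rewrite !inE => /or3P[]->; rewrite ?orbT.
  rewrite ltnS leq_eqVlt => /orP[/eqP/(root_nbrsP N)[]->|]; rewrite ?inE ?eqxx ?orbT //.
  by rewrite ltnS leqn0 => /eqP/lev0_v->; rewrite eqxx.
have cT : #|T| = 8 by rewrite (card_listed us sT).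
have X2 : X <= 2 by move: Xodd; rewrite cT.
have sz : 1 < ex z by rewrite /excess; nlia.
pose g (i : 'I_8) := nth v s i.
have bg : bijective g.
  apply: inj_card_bij; last by rewrite card_ord cT.
  by move=> i j /eqP; rewrite nth_uniq // => /eqP/val_inj.
have nab : ~~ e a b by apply/negP; apply: no_root_edge N.
have nac : ~~ e a c by apply/negP; apply: no_root_edge Nac.
have nbc : ~~ e b c by apply/negP; apply: no_root_edge Nbc.
have nxy := over_pair_nonadj N xP yP.
have nxw := over_pair_nonadj (root_nbrs_swap N) (over_pair_sym xP) wP.
have nyw := over_pair_nonadj (root_nbrs_rot (root_nbrs_rot N)) (over_pair_sym yP) (over_pair_sym wP).
have va : e v a by rewrite -lev1E la.
have vb : e v b by rewrite -lev1E lb.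
have vc : e v c by rewrite -lev1E lc.
have nv t' : 1 < lev t' -> e v t' = false by move=> lt'; rewrite -lev1E; apply/eqP; nlia.
have nz t' : lev t' = 1 -> e t' z = false by move=> lt'; apply/negbTE/nonadj_lev; nlia.
have gQ (i j : 'I_8) : i < j -> e (g i) (g j) = Q3 i j.
  case: i j => [i i8] [j j8] /=.
  do 8?[case: i i8 => [|i] i8 //]; do 8?[case: j j8 => [|j] j8 //];
    rewrite /g /Q3 /bit /= ?va ?vb ?vc ?xz ?yz ?wz ?nv ?lx ?ly ?lw ?lz //;
    rewrite ?nz ?(negPf nab) ?(negPf nac) ?(negPf nbc) ?(negPf nxy) ?(negPf nxw) ?(negPf nyw) //;
    rewrite ?(negPf xc) ?ya ?yc ?wb ?wc ?(negPf yb) ?(negPf wa) // sym ?xa ?xb ?ya ?yc ?wb ?wc ?(negPf xc) ?(negPf yb) ?(negPf wa) //.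
have Q3sym : symmetric Q3 by move=> i j; rewrite /Q3 (eq_sym (bit 0 i)) (eq_sym (bit 1 i)) (eq_sym (bit 2 i)).
case: (bg) => f fK gK; exists f; split; first by exists g.
move=> p q; rewrite -{1}(gK p) -{1}(gK q); case: (ltngtP (f p) (f q)) => [|h|/val_inj ->].
- exact: gQ.
- by rewrite sym Q3sym gQ.
- by rewrite irr /Q3 !eqxx.
Qed.

Lemma cube_of_degree3 : degree e v = 3 -> graph_iso e Q3.
Proof.
move=> d3; have : size (enum [pred y | e v y]) = 3 by rewrite -cardE.
case: (enum _) (enum_uniq [pred y | e v y]) (mem_enum [pred y | e v y]) => [|a [|b [|c []]]] // u E _.
apply: (@cube_of_root_nbrs a b c); split=> // x.
by rewrite E inE lev1E.
Qed.

End Cube.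

End LayeredGraph.

(** * Edge counts of the candles and of the cube *)

Lemma graph_iso_nedges n m (e1 : rel 'I_n) (e2 : rel 'I_m) :
  simple_graph e1 -> graph_iso e1 e2 -> n = m /\ nedges e1 = nedges e2.
Proof.
move=> s1 [f [bf fe]]; case: (bf) => g fK gK; case: (s1) => sym irr.
have s2 : simple_graph e2.
  split=> [x y|x]; first by rewrite -(gK x) -(gK y) -!fe sym.
  by rewrite -(gK x) -fe irr.
split; first by have := bij_eq_card bf; rewrite !card_ord.
apply: double_inj; rewrite -!degree_sum // [RHS](reindex f); last exact: onW_bij.
apply: eq_bigr => x _; rewrite /degree !card_pred_sum [RHS](reindex f); last exact: onW_bij.
by apply: eq_bigr => y _; rewrite fe.
Qed.

Lemma card_level_below m (x : 'I_m) :
  #|[pred y : 'I_m | (level y).+1 == level x]| = (0 < x) + (2 < x).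
Proof.
have xm := ltn_ord x; rewrite /level.
have [x0|x0] := posnP x; first by rewrite x0 (eq_card0 (_ : _ =i pred0)).
have [x2|x2] := ltnP 2 x; last first.
  rewrite (@eq_card1 _ (Ordinal (leq_ltn_trans (leq0n x) xm))) // => y.
  by rewrite !inE -val_eqE /=; apply/eqP/eqP; lia.
(* These are the ordinals of the two vertices one level down, since ordinal [i] carries label
   [i + 1]. *)
have h1 : (x.+1./2).*2 - 3 < m by lia.
have h2 : (x.+1./2).*2 - 2 < m by lia.
rewrite (@eq_card _ _ (pred2 (Ordinal h1) (Ordinal h2))) => [|y].
  by rewrite card2 -val_eqE /=; case: eqP => //; lia.
by rewrite !inE -!val_eqE /=; apply/eqP/orP => [|[]/eqP]; lia.
Qed.

Lemma sum_card_level_below m : 2 < m ->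
  \sum_(x < m) #|[pred y : 'I_m | (level y).+1 == level x]| = m.*2 - 4.
Proof.
move=> m2; under eq_bigr do rewrite card_level_below.
elim: m m2 => // m IH; rewrite ltnS leq_eqVlt => /orP[/eqP<-|m2].
  by rewrite !big_ord_recr big_ord0.
by rewrite big_ord_recr /= IH //; lia.
Qed.

Lemma nedges_by_level n (e : rel 'I_n) : 2 < n -> simple_graph e ->
  (forall x y : 'I_n, e x y -> level y <= (level x).+1) ->
  (forall x y : 'I_n, (level y).+1 = level x -> e x y) ->
  (nedges e).*2 = \sum_(x < n) side e (@level n) x + (n.*2 - 4).*2.
Proof.
move=> n2 sg step compl; rewrite -degree_sum // (degree_sum_levels (proj1 sg) step) big_split /=.
congr (_ + _); rewrite -sum_card_level_below // -muln2 big_distrl /=.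
apply: eq_bigr => x _; rewrite muln2 /down; congr (_.*2); apply: eq_card => y.
by rewrite !inE andbC; case: eqP => //= /compl.
Qed.

Lemma nedges_candle2 k : 2 <= k -> nedges (@candle2 k) = k.*2.*2 - 4.
Proof.
move=> k2; apply: double_inj; rewrite nedges_by_level; [|lia| |..].
- rewrite big1 // => x _; apply: eq_card0 => y; rewrite !inE /candle2.
  by apply/negP; lia.
- split=> [x y|x]; rewrite /candle2; first by rewrite orbC.
  by apply/negP; lia.
- by move=> x y; rewrite /candle2; lia.
- by move=> x y; rewrite /candle2 => <-; rewrite eqxx.
Qed.

Lemma nedges_candle1 k : 1 <= k -> nedges (@candle1 k) = k.*2.+1.*2 - 3.
Proof.
move=> k1; apply: double_inj; rewrite nedges_by_level; [|lia| |..].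
- have h1 : k.*2.-1 < k.*2.+1 by lia.
  have h2 : k.*2 < k.*2.+1 by lia.
  pose p := Ordinal h1; pose q := Ordinal h2.
  have pq : p != q by rewrite -val_eqE /=; lia.
  (* The last two ordinals are the adjacent pair of level [k], and only they have a neighbour in
     their own level. *)
  have sideE x : side (@candle1 k) (@level _) x = (x == p) + (x == q).
    have xk := ltn_ord x.
    have [->|xp] := eqVneq x p.
      rewrite (negPf pq) /side (@eq_card1 _ q) // => y; have yk := ltn_ord y.
      by rewrite !inE /candle1 -!val_eqE /level /=; apply/idP/idP; lia.
    have [->|xq] := eqVneq x q.
      rewrite /side (@eq_card1 _ p) // => y; have yk := ltn_ord y.
      by rewrite !inE /candle1 -!val_eqE /level /=; apply/idP/idP; lia.
    rewrite /side eq_card0 // => y; have yk := ltn_ord y; move: xp xq.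
    by rewrite !inE /candle1 -!val_eqE /level /=; lia.
  rewrite (eq_bigr _ (fun x _ => sideE x)) big_split /= -!big_mkcond !big_pred1_eq.
  lia.
- split=> [x y|x]; rewrite /candle1; last by rewrite eqxx; apply/negP; lia.
  by rewrite orbCA [in RHS]orbA [in LHS]orbA [x == y]eq_sym; do ![case: (_ == _)].
- by move=> x y; rewrite /candle1; lia.
- by move=> x y; rewrite /candle1 => <-; rewrite eqxx.
Qed.

Lemma nedges_Q3 : nedges Q3 = 12.
Proof.
rewrite /nedges cardsE card_pred_sum -(pair_bigA _ (fun x y : 'I_8 => ((x < y) && Q3 x y : nat))) /=.
by rewrite !big_ord_recl !big_ord0.
Qed.

(** If some vertex is at level 2 or more from [v], a vertex of level 2 has two parents, both
    adjacent to [v]; otherwise every other vertex is adjacent to [v]. *)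
Lemma degree_ge2 (T : finType) (e : rel T) : symmetric e -> irreflexive e ->
  connected_graph e -> 2 < #|T| ->
  (forall x y k, x != y -> ~~ e x y -> e x k -> e y k ->
    exists2 l, l != k & e x l && e y l) ->
  forall v, 2 <= degree e v.
Proof.
move=> sym irr conn T3 P1 v; have [lev lay] := layering_exists v sym conn.
have lv : lev v = 0 by apply/eqP; rewrite (lev_root lay).
have [x /= x2|low] := pickP [pred x | 1 < lev x].
  have [y ly] := level_inhabited lay x2.
  have [|p [q [pq yp yq lp lq]]] := @two_parents _ _ _ _ sym P1 lay y; first by rewrite ly.
  rewrite /degree -[2]/(size [:: p; q]) -(card_uniqP (_ : uniq [:: p; q])) /= ?inE ?pq //.
  apply/subset_leq_card/subsetP => z; rewrite !inE -(lev1E sym irr lay).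
  by move=> /orP[]/eqP->; lia.
have top x : lev x <= 1 by rewrite leqNgt; have /= -> := low x.
have := card_levels top; rewrite !big_ord_recl big_ord0 /= addn0.
rewrite (eq_card (lev_root lay)) card1 (@eq_card _ [pred x | lev x == 1] [pred x | e v x]); last exact: lev1E.
by move=> cT; move: T3; rewrite {}cT.
Qed.

(** * Graphs at or below the bound, and the conclusion *)

Section SparseGraphs.
Variables (n : nat) (e : rel 'I_n).
Hypotheses (n3 : 3 <= n) (sg : simple_graph e) (conn : connected_graph e).
Hypothesis second_nbr : forall x y k, x != y -> ~~ e x y -> e x k -> e y k ->
  exists2 l, l != k & e x l && e y l.
Hypothesis no_three_sharing : forall x y z p q,
  x != y -> x != z -> y != z -> ~~ e x y -> ~~ e x z -> ~~ e y z -> p != q ->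
  (forall k, e x k && e y k = (k == p) || (k == q)) ->
  (forall k, e x k && e z k = (k == p) || (k == q)) ->
  (forall k, e y k && e z k = (k == p) || (k == q)) -> False.
Hypothesis bipartite : forall c : 'I_n -> bool, (forall i j, e i j -> c i != c j) -> ~~ odd n.

(** The hypothesis puts [nedges e] at or below the bound for both parities at once. Minimum degree 4
    would give [2n] edges; for a root of degree 2 or 3, [degree_excess] turns it into a bound on the
    excess. *)
Lemma sparse_graph_iso : nedges e + 4 <= n.*2 + odd n ->
  [\/ graph_iso e Q3,
      exists k, [/\ 2 <= k, n = k.*2 & graph_iso e (@candle2 k)] |
      exists k, [/\ 1 <= k, n = k.*2.+1 & graph_iso e (@candle1 k)]].
Proof.
move=> sparse; case: (sg) => sym irr.
have i0 : 'I_n by exists 0; lia.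
case: (arg_minnP (degree e) (erefl (xpredT i0))) => v _ vmin.
have [lev lay] := layering_exists v sym conn.
have count := degree_excess sym irr second_nbr lay.
rewrite (degree_sum sg) card_ord in count.
have vle3 : degree e v <= 3.
  rewrite leqNgt; apply/negP => v4.
  have : n * 4 <= \sum_x degree e x.
    rewrite -[n in n * 4](card_ord n) -sum_nat_const; apply: leq_sum => x _.
    exact: leq_trans v4 (vmin x isT).
  by rewrite (degree_sum sg); case: (odd n) sparse; lia.
have vge2 : 2 <= degree e v by apply: degree_ge2; rewrite ?card_ord.
have odd_side : odd n -> exists x y, e x y /\ lev y = lev x.
  move=> on; have [[x y] /andP[/= xy /eqP lxy]|none] :=
    pickP [pred p : 'I_n * 'I_n | e p.1 p.2 && (lev p.2 == lev p.1)]; first by exists x, y.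
  suff : ~~ odd n by rewrite on.
  (* Without edges inside levels, the parity of the level is a proper 2-colouring. *)
  apply: (bipartite (c := fun x => odd (lev x))) => x y xy.
  have := none (x, y); rewrite /= xy /= => lxy; have := lev_adj sym lay xy; lia.
have [d2|d2] := eqVneq (degree e v) 2; last first.
  constructor 1; apply: (cube_of_degree3 sym irr second_nbr lay).
  - by move=> x; have := vmin x isT; lia.
  - by rewrite card_ord; lia.
  - by rewrite card_ord.
  - by lia.
have Xodd : \sum_x excess e lev x <= (odd #|'I_n|).*2 by rewrite card_ord; lia.
have X2 : \sum_x excess e lev x <= 2 by move: Xodd; case: (odd _); lia.
(* Three downward neighbours cost two units and an edge inside a level one at each end, more than 2
   in all; for even order no unit is available. *)
have down2 x : down e lev x <= 2.
  rewrite leqNgt; apply/negP => dx.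
  have ox : 1 < excess e lev x by rewrite /excess; lia.
  have [|y [z [yz lyz]]] := odd_side.
    apply: contraT => en; move: Xodd; rewrite card_ord (negPf en) (bigD1 x) //=; lia.
  have sy := excess_side1 yz lyz.
  have sz : 0 < excess e lev z by apply: (@excess_side1 _ _ _ z y); rewrite // sym.
  have [xy|xy] := eqVneq x y.
    have sx : 0 < side e lev x by apply/card_gt0P; exists z; rewrite !inE xy yz lyz eqxx.
    have s3 : 2 < excess e lev y by rewrite -xy /excess; lia.
    by have := leq_trans (leq_trans (leq_add s3 sz) (budget2 e lev (adj_neq irr yz))) X2.
  by have := leq_trans (leq_trans (leq_add ox sy) (budget2 e lev xy)) X2.
case: (ladder_candle sym irr second_nbr lay no_three_sharing X2 down2 d2 Xodd).
  by rewrite card_ord => h; constructor 2.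
by rewrite card_ord => h; constructor 3.
Qed.

End SparseGraphs.

Theorem mainTheorem1 (R : realType) (n : nat) (e : rel 'I_n) :
  (3 <= n)%N -> simple_graph e -> connected_graph e -> qG_eq R e 2 ->
  (if odd n then (n.*2 - 3 <= nedges e)%N else (n.*2 - 4 <= nedges e)%N) /\
  (~~ odd n ->
     (nedges e = n.*2 - 4 <->
      graph_iso e Q3 \/
      exists k, [/\ (2 <= k)%N, n = k.*2 & graph_iso e (@candle2 k)])) /\
  (odd n ->
     (nedges e = n.*2 - 3 <->
      exists k, [/\ (1 <= k)%N, n = k.*2.+1 & graph_iso e (@candle1 k)])).
Proof.
move=> n3 sg conn [[A [eA [ev [_ szev eigA]]]] _].
case: ev szev eigA => [|l [|m []]] //= _ eigA.
have [sym irr] := sg.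
have quadA := two_eigenvalues_quadratic (proj1 eA) (fun a => etrans (esym (eigA a))).
have isoE : nedges e + 4 <= n.*2 + odd n -> _ := sparse_graph_iso n3 sg conn
  (fun x y k => second_common_nbr eA quadA irr)
  (fun x y z p q => no_three_sharing_pair eA quadA irr)
  (fun c => bipartite_even eA quadA sg conn (ltnW n3)).
have q3E : graph_iso e Q3 -> n = 8 /\ nedges e = 12.
  by move=> /(graph_iso_nedges sg); rewrite nedges_Q3.
have c2E : (exists k, [/\ 2 <= k, n = k.*2 & graph_iso e (@candle2 k)]) ->
    ~~ odd n /\ nedges e = n.*2 - 4.
  case=> k [k2 nk /(graph_iso_nedges sg)[_ ->]].
  by rewrite nedges_candle2 // nk odd_double.
have c1E : (exists k, [/\ 1 <= k, n = k.*2.+1 & graph_iso e (@candle1 k)]) ->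
    odd n /\ nedges e = n.*2 - 3.
  case=> k [k1 nk /(graph_iso_nedges sg)[_ ->]].
  by rewrite nedges_candle1 // nk /= odd_double.
split; last split=> [en|on].
(* One inequality covers both parities. A graph strictly below it would be one of the extremal
   graphs, whose edge counts meet the bound exactly. *)
- suff bound : n.*2 + odd n <= nedges e + 4 by case: (odd n) bound; lia.
  rewrite leqNgt; apply/negP => lt.
  case: (isoE (ltnW lt)) => [/q3E[nE]|/c2E[]|/c1E[]].
  + by move=> E; move: lt; rewrite E => {E}; rewrite [n in X in _ < X]nE.
  + by move/negPf => en; move: lt; rewrite en; lia.
  + by move=> on; move: lt; rewrite on; lia.
- split=> [E|].
    have [||?|/c1E[]] := isoE; rewrite ?(negPf en) //; [lia | by left | by right].
  by case=> [/q3E[nE ->]|/c2E[]] //; rewrite nE.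
- split=> [E|/c1E[]] //.
  have [|/q3E[nE]|/c2E[]|] := isoE; rewrite ?on //; [lia | by rewrite nE in on].
Qed.
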